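(* If $G$ is a planar graph, then $\chi_\ell(G^2)\le 2\Delta(G)+34$.
   Context: Graphs are finite and simple; $\Delta(G)$ is the maximum degree. $G^2$ is the graph on $V(G)$ in which two vertices are adjacent when their distance in $G$ is $1$ or $2$. $\chi_\ell(H)$ is the least $k$ such that for every assignment of lists of size $k$ to the vertices of $H$ there is a proper coloring of $H$ choosing each vertex's color from its list. *)

(* Defs.v *)
From HB Require Import structures.
From mathcomp Require Import all_boot all_order all_algebra.
From mathcomp Require Import boolp classical_sets reals topology normedtype.

Set Implicit Arguments.
Unset Strict Implicit.
Unset Printing Implicit Defensive.

Import Order.TTheory GRing.Theory Num.Theory.
Import numFieldNormedType.Exports.

Record sgraph := SGraph {
  vertex :> finType;
  adj : rel vertex;
  adj_sym : symmetric adj;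
  adj_irr : irreflexive adj }.

Definition degree (G : sgraph) (v : G) : nat := #|[pred w | adj v w]|.

Definition max_degree (G : sgraph) : nat := \max_(v : G) degree v.

Definition walk (G : sgraph) (n : nat) (u v : G) : bool :=
  [exists p : n.-tuple G, path (@adj G) u p && (last u p == v)].

(* The distance from u to v is defined and equal to n. *)
Definition at_dist (G : sgraph) (n : nat) (u v : G) : bool :=
  walk n u v && [forall m : 'I_n, ~~ walk m u v].

Definition square_adj (G : sgraph) : rel G :=
  [rel u v | at_dist 1 u v || at_dist 2 u v].

Lemma walk_sym (G : sgraph) n (u v : G) : walk n u v = walk n v u.
Proof.
suff imp (x y : G) : walk n x y -> walk n y x by apply/idP/idP; apply: imp.
move=> /existsP[p /andP[pth /eqP <-]]; apply/existsP.
have sz : size (rev (belast x p)) == n by rewrite size_rev size_belast size_tuple.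
exists (Tuple sz); rewrite /= rev_path; apply/andP; split.
  by rewrite (eq_path (e' := @adj G)) // => a b /=; rewrite adj_sym.
case: (tval p) => [|a s] //=.
by rewrite rev_cons last_rcons.
Qed.

Lemma square_adj_sym (G : sgraph) : symmetric (@square_adj G).
Proof.
have H n (u v : G) : at_dist n u v = at_dist n v u.
  rewrite /at_dist walk_sym; congr andb.
  by apply: eq_forallb => m; rewrite walk_sym.
by move=> u v; rewrite /square_adj /= (H 1) (H 2).
Qed.

Lemma square_adj_irr (G : sgraph) : irreflexive (@square_adj G).
Proof.
have W (u : G) : walk 0 u u by apply/existsP; exists [tuple]; rewrite /= eqxx.
have H n (u : G) : at_dist n.+1 u u = false.
  apply/negbTE/negP => /andP[_ /forallP/(_ ord0)] /=.
  by rewrite W.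
by move=> u; rewrite /square_adj /= !H.
Qed.

Definition square (G : sgraph) : sgraph :=
  SGraph (@square_adj_sym G) (@square_adj_irr G).

(* Finitely many finite lists only involve finitely many colors, so it is no
   restriction to draw the lists from an arbitrary finite type. *)
Definition choosable (H : sgraph) (k : nat) : Prop :=
  forall (C : finType) (L : H -> {set C}), (forall v, #|L v| = k) ->
  exists c : H -> C,
    (forall v, c v \in L v) /\ (forall u v, adj u v -> c u != c v).

Lemma choosable_card (H : sgraph) : choosable H #|H|.
Proof.
move=> C L cardL.
have [c0 c0L] : exists c : H -> C, forall v, c v \in L v.
  apply: (@fin_all_exists H (fun=> C) (fun v x => x \in L v)) => v.
  by apply/set0Pn; rewrite -card_gt0 cardL; apply/card_gt0P; exists v.
suff [c [cL cinj]] : exists c : H -> C, (forall v, c v \in L v) /\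
    {in enum H &, injective c}.
  exists c; split=> // u v uv; apply/eqP => cuv.
  have e : u = v by apply: cinj; rewrite ?mem_enum.
  by move: uv; rewrite e adj_irr.
have := enum_uniq H; have : size (enum H) <= #|H| by rewrite -cardE.
elim: (enum H) => [_ _|x s IH /= ltsH /andP[xs us]]; first by exists c0.
have [c [cL cinj]] := IH (ltnW ltsH) us.
have /subsetPn[y yL yc] : ~~ (L x \subset map c s).
  apply/negP => /subset_leq_card; rewrite cardL leqNgt => /negP; apply.
  by apply: leq_ltn_trans (card_size _) _; rewrite size_map.
exists (fun v => if v == x then y else c v); split.
  by move=> v; case: eqP => // ->.
have sP a : a \in x :: s -> a != x -> a \in s.
  by rewrite inE => /orP[->|].
move=> a b ain bin; case: (eqVneq a x) => [->|ax]; case: (eqVneq b x) => [->|bx] //.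
- by move=> e; move: yc; rewrite e map_f // sP.
- by move=> e; move: yc; rewrite -e map_f // sP.
- by apply: cinj; apply: sP.
Qed.

Lemma choosable_ex (H : sgraph) : exists k, `[< choosable H k >].
Proof. by exists #|H|; apply/asboolP/choosable_card. Qed.

Definition list_chromatic_number (H : sgraph) : nat :=
  ex_minn (choosable_ex H).

Local Open Scope ring_scope.

(* pt u is the point representing u; for adjacent u and v, arc u v is a simple
   curve, parametrized by [0, 1], representing the edge uv, and arc v u is the
   same curve traversed backwards. *)
Record plane_drawing (R : realType) (G : sgraph)
    (pt : G -> R * R) (arc : G -> G -> R -> R * R) : Prop := PlaneDrawing {
  pt_inj : injective pt;
  arc_cont : forall u v, adj u v ->
    {within `[0, 1], continuous (arc u v)}%classic;
  arc_inj : forall u v, adj u v -> {in `[0, 1] &, injective (arc u v)};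
  arc_start : forall u v, adj u v -> arc u v 0 = pt u;
  arc_end : forall u v, adj u v -> arc u v 1 = pt v;
  arc_rev : forall u v (t : R), adj u v -> t \in `[0, 1] ->
    arc v u t = arc u v (1 - t);
  arc_vertex : forall u v w (t : R), adj u v -> t \in `]0, 1[ ->
    arc u v t <> pt w;
  arc_cross : forall u v u' v' (t t' : R), adj u v -> adj u' v' ->
    (u, v) <> (u', v') -> (u, v) <> (v', u') ->
    t \in `]0, 1[ -> t' \in `]0, 1[ -> arc u v t <> arc u' v' t' }.

Definition planar (R : realType) (G : sgraph) : Prop :=
  exists (pt : G -> R * R) (arc : G -> G -> R -> R * R),
    plane_drawing pt arc.

(* Main.v *)
Require Import Defs.
From Stdlib Require Import Btauto.
From mathcomp Require Import boolp classical_sets reals topology normedtype derive.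
From mathcomp Require Import all_boot all_order all_algebra.
From mathcomp Require Import lra zify.

(** The argument uses only that a planar graph has no [K_{3,3}] or [K_5] minor.

    For such a minor, draw the edge between two branch sets as a walk in [G]
    through their union; walks for disjoint edges of the minor stay at positive
    distance, so they may be replaced by fine polylines.  For disjoint polylines
    [P] and [Q] the difference [p - q] never vanishes on [P * Q], so it crosses
    the positive horizontal ray an even number of times along the boundary of
    [P * Q].  Adding these relations over all pairs of disjoint edges of
    [K_{3,3}] or [K_5], every crossing number occurs twice, and what is left is
    [1 = 0] modulo 2 (this is van Kampen's obstruction).

    Excluding both minors gives [6 n] as a strict upper bound for the degree sum
    (Mader) and [2 |B|] as an upper bound for the number of vertices outside [B]
    with three given neighbours in [B].  Double counting then yields a vertex
    [v] of degree at most 5, at most two of whose neighbours have degree at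
    least [18 - 2 deg v].  Contract [v] into its neighbour of least degree,
    colour the square of the smaller graph, and colour [v] last: if [D] is the
    maximum degree, at most [2 D + 21] vertices are within distance two of [v]. *)

Set Implicit Arguments.
Unset Strict Implicit.
Unset Printing Implicit Defensive.

Import Order.TTheory GRing.Theory Num.Theory.
Import numFieldNormedType.Exports.

(** * Contractions *)

Section RelationGraphs.

Context {V : finType}.
Implicit Types (e g : rel V) (v w x y z : V) (S : {set V}).

Definition nbrs e x : {set V} := [set y | e x y].

Definition deg e x : nat := #|nbrs e x|.

(** All graphs live on the fixed type [V]; the current vertex set is a set [S] containing the ends
    of every edge. *)
Definition supported e S : Prop := forall x y, e x y -> (x \in S) && (y \in S).

(* [v] is merged into [w]; the vertex [v] becomes isolated. *)
Definition contract e v w : rel V :=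
  [rel x y | [&& x != v, y != v, x != y &
    [|| e x y, (x == w) && e v y | (y == w) && e v x]]].

Lemma contract_sym e v w : symmetric e -> symmetric (contract e v w).
Proof.
move=> es x y; rewrite /contract /= (es x y) [y == x]eq_sym.
by rewrite andbCA; do 3!congr andb; congr orb; rewrite orbC.
Qed.

Lemma contract_irr e v w : irreflexive (contract e v w).
Proof. by move=> x; rewrite /contract /= eqxx !andbF. Qed.

Lemma contract_supported e v w S : symmetric e -> e v w ->
  supported e S -> supported (contract e v w) (S :\ v).
Proof.
move=> es evw sup x y /and4P[xv yv _ H]; rewrite !inE xv yv /=.
case/or3P: H => [/sup //|/andP[/eqP-> /sup /andP[_ ->]]|/andP[/eqP-> /sup /andP[_ ->]]].
  by have /andP[_ ->] := sup _ _ evw.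
by have /andP[_ ->] := sup _ _ evw.
Qed.

(** Merging [v] and [w] costs [z] a neighbour only if [z] sees both. *)
Lemma deg_contract_ge e v w z : symmetric e -> irreflexive e ->
  z != v -> z != w -> deg e z <= deg (contract e v w) z + (e z v && e z w).
Proof.
move=> es ei zv zw.
have sub : nbrs e z :\ v \subset nbrs (contract e v w) z.
  apply/subsetP=> y; rewrite !inE => /andP[yv ezy]; rewrite /contract /= zv yv ezy /= andbT.
  by apply: contraTneq ezy => ->; rewrite ei.
rewrite /deg (cardsD1 v (nbrs e z)) inE.
case: (boolP (e z v)) => [ezv|_] /=; last by rewrite addn0 add0n subset_leq_card.
case: (boolP (e z w)) => [_|ezw] /=; first by rewrite addnC leq_add2r subset_leq_card.
have wN : w \notin nbrs e z :\ v by rewrite !inE (negbTE ezw) andbF.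
have := cardsU1 w (nbrs e z :\ v); rewrite wN addn0 => <-.
apply/subset_leq_card/subsetP=> y; rewrite in_setU1 => /orP[/eqP->|].
  rewrite inE /contract /= zv zw /= (es v z) ezv eqxx !orbT !andbT.
  by apply: contraTneq ezv => <-; rewrite (negbTE ezw).
by move/(subsetP sub).
Qed.

Lemma contract_nbrs_w e v w : symmetric e -> irreflexive e -> e v w ->
  nbrs (contract e v w) w = (nbrs e w :|: nbrs e v) :\ v :\ w.
Proof.
move=> es ei evw; apply/setP=> y; rewrite !inE /contract /= eqxx /=.
have wv : w != v by apply: contraTneq evw => ->; rewrite ei.
rewrite wv /= [w == y]eq_sym; case: (eqVneq y w) => [->|yw] /=; first by rewrite !andbF.
by rewrite orbF.
Qed.

(** Inclusion-exclusion for the two neighbourhoods; the 2 stands for [v] and [w], which lie in the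
    union and are removed. *)
Lemma deg_contract_w e v w : symmetric e -> irreflexive e -> e v w ->
  deg e w + deg e v =
  deg (contract e v w) w + 2 + #|nbrs e v :&: nbrs e w|.
Proof.
move=> es ei evw; rewrite /deg contract_nbrs_w //.
have wv : w != v by apply: contraTneq evw => ->; rewrite ei.
rewrite -[LHS]cardsUI (cardsD1 v (_ :|: _)) (cardsD1 w (_ :\ v)) !inE.
rewrite wv (es w v) evw !ei orbT /= setIC.
lia.
Qed.

Lemma deg_contract_le e v w z : symmetric e -> z != w -> z != v ->
  deg (contract e v w) z <= deg e z.
Proof.
move=> es zw zv; rewrite /deg.
case: (boolP (e z v)) => [ezv|ezv].
  rewrite (cardsD1 v (nbrs e z)) inE ezv.
  apply: (@leq_trans #|w |: (nbrs e z :\ v)|); last by rewrite cardsU1 leq_add2r leq_b1.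
  apply/subset_leq_card/subsetP=> y; rewrite !inE /contract /= (negbTE zw) /=.
  by case/and4P=> _ -> _ /orP[->|/andP[-> _]] //; rewrite orbT.
apply/subset_leq_card/subsetP=> y; rewrite !inE /contract /= (negbTE zw) /=.
by case/and4P=> _ _ _ /orP[->|/andP[_]] //; rewrite (es v z) (negbTE ezv).
Qed.

Lemma deg_contract_v e v w : deg (contract e v w) v = 0.
Proof.
by apply/eqP; rewrite cards_eq0; apply/eqP/setP=> y; rewrite !inE /contract /= eqxx.
Qed.

(** The edge [vw] accounts for 2; each common neighbour costs one at itself and one at [w]. *)
Lemma contract_sum_deg e v w S : symmetric e -> irreflexive e -> e v w ->
  supported e S ->
  \sum_(x in S) deg e x <=
  \sum_(x in S :\ v) deg (contract e v w) x + 2 + 2 * #|nbrs e v :&: nbrs e w|.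
Proof.
move=> es ei evw sup; have /andP[vS wS] := sup _ _ evw.
have wv : w != v by apply: contraTneq evw => ->; rewrite ei.
have wSv : w \in S :\ v by rewrite !inE wv.
rewrite (big_setD1 v) //= (big_setD1 w) //= (big_setD1 w wSv) /=.
have := deg_contract_w es ei evw; set c := #|_ :&: _| => E.
have : \sum_(z in S :\ v :\ w) deg e z <=
    \sum_(z in S :\ v :\ w) deg (contract e v w) z +
    \sum_(z in S :\ v :\ w) (e z v && e z w).
  rewrite -big_split; apply: leq_sum => z; rewrite !inE => /and3P[zw zv _].
  exact: deg_contract_ge.
have : \sum_(z in S :\ v :\ w) (e z v && e z w : nat) <= c.
  rewrite /c -sum1_card big_mkcond [X in _ <= X]big_mkcond; apply: leq_sum => z _.
  by rewrite !inE (es v z) (es w z); case: ifP => //; case: (e z v && _).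
lia.
Qed.

End RelationGraphs.

(** * Minors and the average degree *)

Section Minors.

Context {V : finType}.
Implicit Types (e g : rel V) (v w x y z : V) (S : {set V}).

Definition induced g (A : {set V}) : rel V :=
  [rel a b | [&& a \in A, b \in A & g a b]].

(* The graph [e] is a minor of [g]: [U x] is the branch set of [x], which may
   be empty only if [x] is isolated in [e]. *)
Definition minor_of g e : Prop := exists U : V -> {set V},
  [/\ forall x, {in U x &, forall a b, connect (induced g (U x)) a b},
      forall x y, x != y -> [disjoint U x & U y] &
      forall x y, e x y -> exists a b, [/\ a \in U x, b \in U y & g a b]].

Lemma minor_refl g : minor_of g g.
Proof.
exists (fun x => [set x]); split=> [x a b /set1P-> /set1P-> //|x y xy|x y gxy].
  by rewrite disjoints1 inE.
by exists x, y; rewrite !set11.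
Qed.

Lemma minor_sub g e e' : minor_of g e -> subrel e' e -> minor_of g e'.
Proof. by case=> U [Uc Ud Ue] sub; exists U; split=> // x y /sub /Ue. Qed.

Lemma induced_sub g (A B : {set V}) : A \subset B ->
  subrel (connect (induced g A)) (connect (induced g B)).
Proof.
move=> /subsetP AB; apply: connect_sub => a b /and3P[aA bA gab].
by apply: connect1; rewrite /induced /= !AB.
Qed.

Lemma induced_connect_sym g A : symmetric g -> connect_sym (induced g A).
Proof.
by move=> gs; apply: sym_connect_sym => a b; rewrite /induced /= gs andbCA.
Qed.

(** The branch set of [v] is moved into that of [w]; the edge of [g] between them keeps the union
    connected. *)
Lemma minor_contract g e v w : symmetric g -> minor_of g e -> e v w -> v != w ->
  minor_of g (contract e v w).
Proof.
move=> gs [U [Uc Ud Ue]] evw vw.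
exists (fun x => if x == v then set0 else if x == w then U w :|: U v else U x).
split=> [x|x y xy|x y].
- case: eqP => _; first by move=> a b; rewrite inE.
  case: eqP => _ //.
  have [a0 [b0 [a0v b0w gab]]] := Ue _ _ evw.
  have sw : U w \subset U w :|: U v by apply: subsetUl.
  have sv : U v \subset U w :|: U v by apply: subsetUr.
  have to_b0 a : a \in U w :|: U v -> connect (induced g (U w :|: U v)) a b0.
    case/setUP => [aw|av]; first exact: (induced_sub sw (Uc _ _ _ aw b0w)).
    apply: connect_trans (induced_sub sv (Uc _ _ _ av a0v)) _.
    by apply: connect1; rewrite /induced /= gab !inE a0v b0w orbT.
  move=> a b aU bU; apply: connect_trans (to_b0 _ aU) _.
  by rewrite induced_connect_sym // to_b0.
- case: (eqVneq x v) => [_|xv]; first by rewrite disjoints_subset sub0set.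
  case: (eqVneq y v) => [_|yv]; first by rewrite disjoint_sym disjoints_subset sub0set.
  case: (eqVneq x w) => [xw|xw]; case: (eqVneq y w) => [yw|yw].
  + by move: xy; rewrite xw yw eqxx.
  + by rewrite -setI_eq0 setIUl setU_eq0 !setI_eq0 !Ud // eq_sym.
  + by rewrite -setI_eq0 setIUr setU_eq0 !setI_eq0 !Ud.
  + exact: Ud.
- move=> /and4P[xv yv xy]; rewrite (negbTE xv) (negbTE yv).
  case/or3P=> [/Ue[a [b [aU bU gab]]]|/andP[/eqP-> /Ue[a [b [aU bU gab]]]]|].
  + exists a, b; split=> //; case: eqP => [E|_]; rewrite ?inE -?E ?aU ?bU //.
  + exists a, b; rewrite eqxx !inE aU orbT; split=> //.
    by case: eqP => [E|_] //; rewrite !inE -E bU.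
  + case/andP=> /eqP-> /Ue[a [b [aU bU gab]]].
    exists b, a; rewrite eqxx !inE aU orbT gs; split=> //.
    by case: eqP => [E|_] //; rewrite !inE -E bU.
Qed.

Definition has_K33 e : Prop := exists s t,
  [/\ size s = 3, size t = 3, uniq (s ++ t) & allrel e s t].

Definition has_K5 e : Prop := exists s, [/\ size s = 5, uniq s & pairwise e s].

Definition no_K33_K5_minor g : Prop := forall e, symmetric e -> minor_of g e ->
  ~ has_K33 e /\ ~ has_K5 e.

Definition delete_edge e x y : rel V := [rel a b |
  e a b && ~~ ((a == x) && (b == y) || (a == y) && (b == x))].

Lemma deg_delete_edge e x y z : x != y ->
  deg e z <= deg (delete_edge e x y) z + ((z == x) + (z == y)).
Proof.
move=> xy; rewrite /deg; pose w := if z == x then y else x.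
have -> : (z == x) + (z == y) = (z == x) || (z == y).
  by case: (eqVneq z x) => // ->; rewrite (negbTE xy).
rewrite (cardsD1 w); case: (boolP ((z == x) || (z == y))) => [|] zxy; last first.
  rewrite addn0 -(cardsD1 w); apply/subset_leq_card/subsetP => b.
  rewrite !inE /delete_edge /= => -> /=.
  by move: zxy; rewrite negb_or => /andP[/negbTE-> /negbTE->].
rewrite addnC; apply: leq_add; last exact: leq_b1.
apply/subset_leq_card/subsetP=> b; rewrite !inE /delete_edge /= => /andP[bw ->] /=.
move: bw zxy; rewrite /w; case: (eqVneq z x) => [->|_] bw /= zy.
  by rewrite (negbTE bw) (negbTE xy).
by rewrite zy.
Qed.

Lemma deg_sub e e' x : subrel e' e -> deg e' x <= deg e x.
Proof. by move=> sub; apply/subset_leq_card/subsetP=> y; rewrite !inE => /sub. Qed.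

(** Each of the five neighbours misses at most one other. Two nonadjacent ones, or any two if there
    are none, are therefore joined to the remaining three, and so is [x]. *)
Lemma K33_of_nbrs5 e x : symmetric e -> irreflexive e -> deg e x = 5 ->
  (forall y, e x y -> 3 <= #|nbrs e x :&: nbrs e y|) -> has_K33 e.
Proof.
move=> es ei dx many; set N := nbrs e x in many.
have inN y : y \in N = e x y by rewrite inE.
have [a [b [aN bN ab H]]] : exists a b, [/\ a \in N, b \in N, a != b &
    forall c, c \in N -> c != a -> c != b -> e a c && e b c].
  case: (boolP [exists a in N, exists b in N, (a != b) && ~~ e a b]).
    case/exists_inP=> a aN /exists_inP[b bN /andP[ab nab]].
    have key p q : p \in N -> q \in N -> p != q -> ~~ e p q ->
        forall c, c \in N -> c != p -> c != q -> e p c.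
      move=> pN qN pq npq c cN cp cq.
      have sub : N :&: nbrs e p \subset N :\ p :\ q.
        apply/subsetP=> d; rewrite !inE => /andP[-> epd]; rewrite andbT.
        apply/andP; split; apply: contraTneq epd => ->; rewrite ?(negbTE npq) //.
        by rewrite ei.
      have sz : #|N :\ p :\ q| = 3.
        have := cardsD1 q (N :\ p); rewrite in_setD1 qN eq_sym pq.
        have := cardsD1 p N; rewrite pN -[#|N|]/(deg e x) dx; clear; lia.
      have /eqP E : N :&: nbrs e p == N :\ p :\ q.
        by rewrite eqEcard sub sz many // -inN.
      have : c \in N :&: nbrs e p by rewrite E !inE -inN cN cp cq.
      by rewrite !inE => /andP[].
    exists a, b; split=> // c cN ca cb; rewrite (key a b) // (key b a) //.
      by rewrite eq_sym.
    by rewrite es.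
  rewrite negb_exists_in => /forall_inP H.
  have adjN p q : p \in N -> q \in N -> p != q -> e p q.
    move=> pN qN pq; move: (H p pN); rewrite negb_exists_in => /forall_inP/(_ q qN).
    by rewrite pq /= negbK.
  have [a aN] : exists a, a \in N by apply/card_gt0P; move: dx; rewrite /deg -/N => ->.
  have [b] : exists b, b \in N :\ a.
    by apply/card_gt0P; have := cardsD1 a N; move: dx; rewrite /deg -/N aN; lia.
  rewrite 2!inE => /andP[ba bN]; exists a, b; split=> //; first by rewrite eq_sym.
  by move=> c cN ca cb; rewrite !adjN // eq_sym.
exists [:: x; a; b], (enum (N :\ a :\ b)); split=> //.
- rewrite -cardE; have := cardsD1 a N; have := cardsD1 b (N :\ a).
  by move: dx; rewrite /deg -/N 2!inE aN bN eq_sym ab /=; lia.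
- rewrite cat_uniq enum_uniq andbT /= !inE !negb_or ab andbT.
  rewrite andbT andbC.
  have nx d : d \in N -> x != d by rewrite inN; apply: contraTneq => <-; rewrite ei.
  rewrite !nx //= andbT; apply/hasPn=> c; rewrite mem_enum !inE => /and3P[cb ca cx].
  by rewrite (negbTE ca) (negbTE cb) !orbF eq_sym nx // inN.
apply/allrelP=> p q; rewrite mem_enum !inE => pxab /and3P[qb qa exq].
have /andP[eaq ebq] : e a q && e b q by apply: H; rewrite ?inE.
by case/or3P: pxab => /eqP->.
Qed.

(** Three common neighbours among only four force the neighbourhood to be a clique. *)
Lemma K5_of_nbrs4 e x : symmetric e -> irreflexive e -> deg e x = 4 ->
  (forall y, e x y -> 3 <= #|nbrs e x :&: nbrs e y|) -> has_K5 e.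
Proof.
move=> es ei dx many; set N := nbrs e x in many.
have inN y : y \in N = e x y by rewrite inE.
exists (x :: enum N); split; first by rewrite /= -cardE -[#|_|]/(deg e x) dx.
  by rewrite /= enum_uniq mem_enum inN ei.
rewrite pairwise_cons; apply/andP; split.
  by apply/allP=> y; rewrite mem_enum inN.
have : pairwise (fun a b : V => a != b) (enum N) by rewrite -uniq_pairwise enum_uniq.
apply: (@sub_in_pairwise _ (mem N)); last by apply/allP=> y; rewrite mem_enum.
move=> p q pN qN pq.
have sub : N :&: nbrs e p \subset N :\ p.
  apply/subsetP=> d; rewrite !inE => /andP[-> epd]; rewrite andbT.
  by apply: contraTneq epd => ->; rewrite ei.
have /eqP E : N :&: nbrs e p == N :\ p.
  rewrite eqEcard sub /=; apply: leq_trans (many _ _); last by rewrite -inN.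
  by have := cardsD1 p N; move: dx; rewrite /deg -/N pN; lia.
have : q \in N :&: nbrs e p by rewrite E 2!inE qN eq_sym pq.
by rewrite !inE => /andP[].
Qed.

(* Mader's argument: contracting an edge in at most two triangles costs at most
   three edges, and if there is no such edge, then a vertex of degree at most
   5 together with its neighbours contains [K_5] or [K_{3,3}]. *)
Lemma sum_deg_minor g e S : symmetric g -> no_K33_K5_minor g ->
  symmetric e -> irreflexive e -> minor_of g e -> supported e S ->
  0 < #|S| -> \sum_(x in S) deg e x + 6 <= 6 * #|S|.
Proof.
(* This measure drops under contraction, edge deletion and removal of an isolated vertex alike. *)
move=> gs gK; have [n] := ubnP (#|S| + \sum_(x in S) deg e x).
elim: n => // n IH in e S *; rewrite ltnS => le_n es ei em sup S0.
case: (boolP [exists x, exists y, e x y && (#|nbrs e x :&: nbrs e y| <= 2)]).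
  case/existsP=> x /existsP[y /andP[exy c2]].
  have /andP[xS yS] := sup _ _ exy.
  have xy : x != y by apply: contraTneq exy => ->; rewrite ei.
  have yS' : 0 < #|S :\ x| by apply/card_gt0P; exists y; rewrite 2!inE eq_sym xy.
  have H := contract_sum_deg es ei exy sup.
  have le_sum : \sum_(z in S :\ x) deg (contract e x y) z <= \sum_(z in S) deg e z.
    rewrite (big_setD1 x xS) /= (big_setD1 y) /=; last by rewrite 2!inE eq_sym xy.
    rewrite [X in _ <= _ + X](big_setD1 y) /=; last by rewrite 2!inE eq_sym xy.
    have := deg_contract_w es ei exy.
    suff : \sum_(i in S :\ x :\ y) deg (contract e x y) i <=
           \sum_(i in S :\ x :\ y) deg e i by lia.
    by apply: leq_sum => i; rewrite !inE => /and3P[iy ix _]; apply: deg_contract_le.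
  have := IH (contract e x y) (S :\ x).
  have := cardsD1 x S; rewrite xS => cS H1.
  have {H1} := H1 _ (contract_sym _ _ es) (contract_irr _ _ _)
    (minor_contract gs em exy xy) (contract_supported es exy sup) yS'.
  by have [?|?] := ltnP (#|S :\ x| + \sum_(x0 in S :\ x) deg (contract e x y) x0) n;
    [move/(_ isT)|]; lia.
move=> /existsPn ne.
have many x y : e x y -> 3 <= #|nbrs e x :&: nbrs e y|.
  by move=> exy; move/existsPn: (ne x) => /(_ y); rewrite exy /= -ltnNge.
case: (boolP [exists x, exists y, e x y]); last first.
  move=> /existsPn H; rewrite big1 ?add0n; first by lia.
  move=> x _; apply/eqP; rewrite cards_eq0; apply/eqP/setP=> y; rewrite !inE.
  by move/existsPn: (H x) => /(_ y) /negbTE.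
case/existsP=> x /existsP[y exy].
have /andP[xS yS] := sup _ _ exy.
have xy : x != y by apply: contraTneq exy => ->; rewrite ei.
(* One edge is deleted so that induction bounds the degree sum of [e] by [6 * #|S| - 6 + 2]; being
   below [6 * #|S|], this yields a vertex of degree at most 5. *)
have sub : subrel (delete_edge e x y) e by move=> a b /andP[].
have del_le : \sum_(z in S) deg e z <= \sum_(z in S) deg (delete_edge e x y) z + 2.
  have -> : 2 = \sum_(z in S) ((z == x) + (z == y)).
    rewrite big_split /= (bigD1 x) //= [X in _ + X](bigD1 y) //= !eqxx.
    by rewrite !big1 // => i /andP[_ /negbTE->].
  by rewrite -big_split; apply: leq_sum => z _; apply: deg_delete_edge.
have del_lt : \sum_(z in S) deg (delete_edge e x y) z < \sum_(z in S) deg e z.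
  rewrite (big_setD1 x xS) [X in _ < X](big_setD1 x xS) /=.
  rewrite -addSn leq_add //; last by apply: leq_sum => z _; apply: deg_sub.
  rewrite /deg [X in _ < X](cardsD1 y) inE exy add1n ltnS.
  apply/subset_leq_card/subsetP=> b; rewrite !inE /delete_edge /= eqxx /=.
  by case/andP=> -> /=; rewrite negb_or => /andP[-> _].
have H1 : \sum_(z in S) deg (delete_edge e x y) z + 6 <= 6 * #|S|.
  apply: IH => //; first by lia.
  - move=> a b; rewrite /delete_edge /= es; congr (_ && ~~ _).
    by rewrite orbC; congr orb; rewrite andbC.
  - by move=> a; rewrite /delete_edge /= ei.
  - exact: minor_sub em sub.
  - by move=> a b /sub; apply: sup.
have [z zS dz] : exists2 z, z \in S & deg e z <= 5.
  apply/exists_inP; apply: contraT; rewrite negb_exists_in => /forall_inP H.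
  have : 6 * #|S| <= \sum_(z in S) deg e z.
    by rewrite -sum1_card big_distrr /=; apply: leq_sum => z /H; rewrite -ltnNge.
  lia.
have [nK33 nK5] := gK e es em.
have [dz0|[u ezu]] : deg e z = 0 \/ exists u, e z u.
  case: (set_0Vmem (nbrs e z)) => [E|[u]]; last by rewrite inE; right; exists u.
  by left; rewrite /deg E cards0.
  have noe a : e z a = false.
    by move/eqP: dz0; rewrite cards_eq0 => /eqP/setP/(_ a); rewrite !inE.
  have sup' : supported e (S :\ z).
    move=> a b eab; have /andP[aS bS] := sup _ _ eab; rewrite !inE aS bS !andbT.
    by apply/andP; split; apply: contraTneq eab => ->; rewrite ?noe // es noe.
  have xSz : x \in S :\ z by have /andP[] := sup' _ _ exy.
  have Sz0 : 0 < #|S :\ z| by apply/card_gt0P; exists x.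
  have := IH e (S :\ z) _ es ei em sup' Sz0.
  have := cardsD1 z S; rewrite zS => cS.
  move: le_n; rewrite (big_setD1 z zS) /= dz0 => le_n /(_ _).
  by move=> H; have := H ltac:(lia); lia.
have dz4 : 4 <= deg e z.
  have := many _ _ ezu; rewrite /deg [X in _ -> _ < X](cardsD1 u) inE ezu add1n ltnS.
  move=> H; apply: leq_trans H _; apply/subset_leq_card/subsetP=> b.
  rewrite !inE => /andP[-> eub]; rewrite andbT.
  by apply: contraTneq eub => ->; rewrite ei.
have [d4|d5] : deg e z = 4 \/ deg e z = 5 by lia.
  by case: nK5; apply: (K5_of_nbrs4 es ei d4) => ? /many.
by case: nK33; apply: (K33_of_nbrs5 es ei d5) => ? /many.
Qed.

End Minors.

(** * Vertices with three neighbours in a set *)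

Section Triples.

Context {V : finType}.
Implicit Types (e g : rel V) (v w x y z : V) (S T B : {set V}).

Definition bipartite e T B : Prop :=
  forall x y, e x y -> (x \in T) && (y \in B) || (x \in B) && (y \in T).

Lemma sum_deg_bipartite e T B : symmetric e -> [disjoint T & B] ->
  bipartite e T B -> \sum_(t in T) deg e t = \sum_(b in B) deg e b.
Proof.
move=> es TB bip.
have count x : deg e x = \sum_y e x y.
  by rewrite /deg -sum1_card big_mkcond; apply: eq_bigr => y _; rewrite inE; case: (e _ _).
transitivity (\sum_(t in T) \sum_(b in B) e t b).
  apply: eq_bigr => t tT; rewrite count [RHS]big_mkcond; apply: eq_bigr => b _.
  case: ifP => // bB; case: (boolP (e t b)) => // /bip; rewrite bB andbF /=.
  by rewrite (disjointFr TB tT).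
rewrite exchange_big; apply: eq_bigr => b bB; rewrite count [LHS]big_mkcond.
apply: eq_bigr => t _; rewrite es; case: ifP => // tT.
case: (boolP (e b t)) => // /bip; rewrite tT andbF orbF.
by rewrite (disjointFl TB bB).
Qed.

Definition restrict e S : rel V := [rel x y | [&& x \in S, y \in S & e x y]].

Lemma restrict_sub e S : subrel (restrict e S) e.
Proof. by move=> x y /and3P[]. Qed.

Lemma restrict_sym e S : symmetric e -> symmetric (restrict e S).
Proof. by move=> es x y; rewrite /restrict /= es andbCA. Qed.

(** Contracting the path [q], [t0], [p] merges [q] into [p]. Common neighbours of [p] and [q], [t0]
    among them, would lose an edge and are dropped; the other triples survive with [q] replaced by
    [p]. *)
Lemma merge_pair_bipartite g e T B t0 p q : symmetric g -> symmetric e ->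
  irreflexive e -> minor_of g e -> [disjoint T & B] -> bipartite e T B ->
  (forall t, t \in T -> deg e t = 3) -> t0 \in T -> e t0 p -> e t0 q -> p != q ->
  let T' := T :\: (nbrs e p :&: nbrs e q) in
  exists e', [/\ symmetric e', irreflexive e', minor_of g e',
    bipartite e' T' (B :\ q) & forall t, t \in T' -> deg e' t = 3].
Proof.
move=> gs es ei em TB bip d3 t0T e0p e0q pq T'.
have inB t b : t \in T -> e t b -> b \in B.
  by move=> tT /bip; rewrite tT (disjointFr TB tT) /= orbF.
have TBne t b : t \in T -> b \in B -> t != b.
  by move=> tT; apply: contraTneq => <-; rewrite (disjointFr TB tT).
have pB := inB _ _ t0T e0p; have qB := inB _ _ t0T e0q.
have TT' t : t \in T' -> [/\ t \in T, t != t0 & ~~ (e t p && e t q)].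
  rewrite !inE => /andP[H tT]; split=> //.
    by apply: contraNneq H => ->; rewrite !(es _ t0) e0p e0q.
  by rewrite !(es t).
(* The contraction also joins [p] to the third neighbour of [t0], an edge inside [B]; [f] selects
   the edges between [T'] and [B :\ q] only. *)
pose f t b := [&& t \in T', b \in B :\ q & e t b || ((b == p) && e t q)].
pose e' := [rel x y | f x y || f y x].
pose e1 := contract e t0 p; pose e2 := contract e1 q p.
have e1s : symmetric e1 by apply: contract_sym.
have e2s : symmetric e2 by apply: contract_sym.
have e1qp : e1 q p.
  by rewrite /e1 /contract /= e0q eqxx !orbT !andbT eq_sym TBne // eq_sym TBne //= eq_sym.
have m2 : minor_of g e2.
  apply: minor_contract => //; last by rewrite eq_sym.
  by apply: minor_contract => //; apply: TBne.
have fe2 x y : f x y -> e2 x y.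
  case/and3P=> /TT'[xT xt0 nx]; rewrite !inE => /andP[yq yB] H.
  have xq := TBne _ _ xT qB; have xy := TBne _ _ xT yB.
  have yt0 : y != t0 by rewrite eq_sym TBne.
  have qt0 : q != t0 by rewrite eq_sym TBne.
  have qx : q != x by rewrite eq_sym.
  rewrite /e2 /contract /= xq yq xy /=.
  case/orP: H => [exy|/andP[yp exq]]; first by rewrite /e1 /contract /= xt0 yt0 xy exy.
  by rewrite yp /e1 /contract /= qt0 xt0 qx [e q x]es exq /= !orbT.
have subf : subrel e' e2 by move=> x y /orP[/fe2|/fe2 H] //; rewrite e2s.
exists e'; split.
- by move=> x y; rewrite /e' /= orbC.
- by move=> x; apply/negP => /subf; rewrite /e2 contract_irr.
- exact: minor_sub m2 subf.
- by move=> x y /orP[/and3P[-> -> _]|/and3P[-> -> _]] //; rewrite orbT.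
move=> t tT'; have [tT tt0 ntpq] := TT' _ tT'.
have E : nbrs e' t = [set b | (b \in B :\ q) && (e t b || ((b == p) && e t q))].
  apply/setP=> b; rewrite [LHS]inE [RHS]inE /e' /= /f tT' /=.
  by rewrite [t \in _]inE (disjointFr TB tT) !andbF orbF.
rewrite /deg E; case: (boolP (e t q)) => [etq|netq].
  have netp : ~~ e t p by move: ntpq; rewrite etq andbT.
  have -> : [set b | (b \in B :\ q) && (e t b || (b == p) && true)] =
      p |: (nbrs e t :\ q).
    apply/setP=> b; rewrite !inE andbT; case: (eqVneq b p) => [->|bp] /=.
      by rewrite pq pB orbT.
    rewrite orbF; case: (boolP (e t b)) => [etb|]; last by rewrite !andbF.
    by rewrite (inB t b) // !andbT.
  have := cardsU1 p (nbrs e t :\ q); rewrite !inE (negbTE netp) andbF /= => ->.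
  by have := cardsD1 q (nbrs e t); rewrite inE etq -[#|nbrs e t|]/(deg e t) d3.
rewrite -(d3 _ tT) /deg; apply: eq_card => b; rewrite !inE andbF orbF.
case: (boolP (e t b)) => [etb|]; last by rewrite !andbF.
by rewrite (inB t b) // !andbT; apply: contraTneq etb => ->.
Qed.

(** Contracting [t3] and [t4] into [r] joins [r] to [b0], [p] and [q], which are already joined to
    [t1] and [t2]. *)
Lemma K33_minor_of_star g e b0 p q r t1 t2 t3 t4 : symmetric g ->
  no_K33_K5_minor g -> symmetric e -> minor_of g e ->
  uniq [:: b0; p; q; r; t1; t2; t3; t4] ->
  all (e t1) [:: b0; p; q] -> all (e t2) [:: b0; p; q] ->
  all (e t3) [:: b0; p; r] -> all (e t4) [:: b0; q; r] -> False.
Proof.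
move=> gs gK es em U A1 A2 A3 A4.
move: A1 A2 A3 A4 => /and4P[e1b e1p e1q _] /and4P[e2b e2p e2q _].
move=> /and4P[e3b e3p e3r _] /and4P[e4b e4q e4r _].
move: U; rewrite /= !inE !negb_or -!andbA.
do ![case/andP=> ?]; move=> _.
have neC x y : x != y -> y != x by rewrite eq_sym.
pose e1 := contract e t3 r; pose e2 := contract e1 t4 r.
have m1 : minor_of g e1 by apply: minor_contract => //; apply: neC.
have m2 : minor_of g e2.
  apply: minor_contract => //; last by apply: neC.
  by rewrite /e1 /contract /= e4r !(neC _ t4) ?(neC t3) ?(neC r).
have e2s : symmetric e2 by do 2!apply: contract_sym.
have sube a b : e a b -> a != b -> a != t3 -> b != t3 -> a != t4 -> b != t4 -> e2 a b.
  by move=> ab *; apply/and4P; split=> //; apply/orP; left; apply/and4P; split=> //; rewrite ab.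
have [nK33 _] := gK e2 e2s m2; apply: nK33.
exists [:: b0; p; q], [:: t1; t2; r]; split=> //.
  rewrite /= !inE !negb_or; do !(apply/andP; split => //); exact: neC.
have ebr : e2 b0 r.
  apply/and4P; split=> //; apply/orP; left; apply/and4P; split=> //.
  by rewrite eqxx e3b !orbT.
have epr : e2 p r.
  apply/and4P; split=> //; apply/orP; left; apply/and4P; split=> //.
  by rewrite eqxx e3p !orbT.
have eqr : e2 q r.
  apply/and4P; split=> //; apply/or3P; apply: Or33; rewrite eqxx /=.
  by apply/and4P; split; rewrite ?e4q //; apply: neC.
by rewrite /allrel /= ebr epr eqr !sube // es.
Qed.

(* If two vertices of [B] with a common neighbour have at most two common
   neighbours, they are merged along one of them, which destroys at most two
   triples.  Otherwise the link of a vertex of [B] of degree at most 5 is so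
   dense that a [K_{3,3}] minor appears. *)
Lemma card_triples g e T B : symmetric g -> no_K33_K5_minor g ->
  symmetric e -> irreflexive e -> minor_of g e -> [disjoint T & B] ->
  bipartite e T B -> (forall t, t \in T -> deg e t = 3) -> 1 < #|B| ->
  #|T| + 4 <= 2 * #|B|.
Proof.
move=> gs gK; have [n] := ubnP (#|T| + #|B|).
elim: n => // n IH in e T B *; rewrite ltnS => le_n es ei em TB bip d3 B2.
have inB t b : t \in T -> e t b -> b \in B.
  by move=> tT /bip; rewrite tT (disjointFr TB tT) /= orbF.
have inT t b : b \in B -> e b t -> t \in T.
  by move=> bB /bip; rewrite bB (disjointFl TB bB).
have TBne t b : t \in T -> b \in B -> t != b.
  by move=> tT; apply: contraTneq => <-; rewrite (disjointFr TB tT).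
have nB t : t \in T -> nbrs e t \subset B.
  by move=> tT; apply/subsetP=> b; rewrite inE; apply: inB.
have [->|[t0 t0T]] := set_0Vmem T; first by rewrite cards0; lia.
have B3 : 2 < #|B| by rewrite -(d3 _ t0T) subset_leq_card // nB.
(* Induction without [t0] gives the claim up to one. This already excludes minimum degree 6 in [B],
   where counting edges would give [2 * #|B| <= #|T|]. *)
have T3 : #|T| + 3 <= 2 * #|B|.
  have cT := cardsD1 t0 T; rewrite t0T in cT.
  suff : #|T :\ t0| + 4 <= 2 * #|B| by lia.
  pose S := ~: [set t0].
  apply: (IH (restrict e S)) => //.
  - by lia.
  - exact: restrict_sym.
  - by move=> x; apply/negP=> /restrict_sub; rewrite ei.
  - by apply: minor_sub em _; apply: restrict_sub.
  - by apply: disjointWl TB; rewrite subsetDl.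
  - move=> x y /and3P[]; rewrite !inE => xt yt /bip.
    by case/orP=> /andP[-> ->]; rewrite ?xt ?yt ?orbT.
  move=> t; rewrite !inE => /andP[tt0 tT]; rewrite -(d3 _ tT).
  apply: eq_card => b; rewrite !inE /restrict /= !inE tt0 /=.
  case: (boolP (e t b)) => [etb|]; last by rewrite andbF.
  by rewrite eq_sym TBne // (inB t).
have [/exists_inP[b bB /eqP db]|] := boolP [exists b in B, deg e b == 0].
  have noe x : e b x = false.
    by move/eqP: db; rewrite cards_eq0 => /eqP/setP/(_ x); rewrite !inE.
  have cB := cardsD1 b B; rewrite bB in cB.
  suff : #|T| + 4 <= 2 * #|B :\ b| by lia.
  apply: (IH e) => //; try by lia.
  - by apply: disjointWr TB; rewrite subsetDl.
  - move=> x y exy; have := bip _ _ exy; rewrite !inE.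
    have -> : x != b by apply: contraTneq exy => ->; rewrite noe.
    by have -> : y != b by apply: contraTneq exy => ->; rewrite es noe.
rewrite negb_exists_in => /forall_inP dB.
have [/exists_inP[t tT /existsP[p /existsP[q /and4P[etp etq pq c2]]]]|] :=
    boolP [exists t in T, exists p, exists q,
      [&& e t p, e t q, p != q & #|nbrs e p :&: nbrs e q| <= 2]].
  have [e' [e's e'i e'm e'b e'd]] :=
    merge_pair_bipartite gs es ei em TB bip d3 tT etp etq pq.
  have qB := inB _ _ tT etq.
  have cB := cardsD1 q B; rewrite qB in cB.
  have cT : #|T| <= #|T :\: (nbrs e p :&: nbrs e q)| + 2.
    rewrite -(cardsID (nbrs e p :&: nbrs e q) T) addnC leq_add2l.
    by apply: leq_trans c2; rewrite subset_leq_card // subsetIr.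
  have : #|T :\: (nbrs e p :&: nbrs e q)| + 4 <= 2 * #|B :\ q|.
    apply: (IH e') => //; last by lia.
      have : #|T :\: (nbrs e p :&: nbrs e q)| <= #|T|.
        by rewrite subset_leq_card // subsetDl.
      by lia.
    apply: disjointW TB; exact: subsetDl.
  by lia.
rewrite negb_exists_in => /forall_inP many0.
have many t p q : t \in T -> e t p -> e t q -> p != q ->
    2 < #|nbrs e p :&: nbrs e q|.
  move=> tT etp etq pq; move: (many0 _ tT) => /existsPn/(_ p)/existsPn/(_ q).
  by rewrite etp etq pq /= -ltnNge.
have [b0 b0B db0] : exists2 b, b \in B & deg e b <= 5.
  apply/exists_inP; apply: contraT; rewrite negb_exists_in => /forall_inP H.
  have : 6 * #|B| <= \sum_(z in B) deg e z.
    by rewrite -sum1_card big_distrr /=; apply: leq_sum => z /H; rewrite -ltnNge.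
  rewrite -(sum_deg_bipartite es TB bip) (eq_bigr (fun=> 3)) // sum_nat_const.
  lia.
set M := nbrs e b0 in db0.
have inM t : t \in M = e b0 t by rewrite inE.
have MT t : t \in M -> t \in T by rewrite inM; apply: inT.
have [tm tmM] : exists t, t \in M.
  by apply/card_gt0P; rewrite lt0n; apply: dB.
pose Q := \bigcup_(t in M) (nbrs e t :\ b0).
have QP p : reflect (p != b0 /\ exists2 t, t \in M & e t p) (p \in Q).
  apply: (iffP bigcupP) => [[t tM]|[pb [t tM etp]]].
    by rewrite !inE => /andP[-> etp]; split=> //; exists t.
  by exists t; rewrite // !inE pb.
have QB p : p \in Q -> p \in B by case/QP=> _ [t /MT tT]; apply: inB.
have mQ p : p \in Q -> 2 < #|M :&: nbrs e p|.
  case/QP=> pb [t tM etp]; apply: (many t) => //; first exact: MT.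
    by rewrite es -inM.
  by rewrite eq_sym.
have two t : t \in M -> #|nbrs e t :\ b0| = 2.
  move=> tM; have := cardsD1 b0 (nbrs e t).
  by rewrite inE es -inM tM -[#|nbrs e t|]/(deg e t) d3 ?MT // => -[].
have subQ t : t \in M -> nbrs e t :\ b0 \subset Q.
  by move=> tM; apply: (bigcup_sup t).
have sumQ : \sum_(p in Q) #|M :&: nbrs e p| = 2 * #|M|.
  transitivity (\sum_(p in Q) \sum_(t in M) e t p).
    apply: eq_bigr => p _; rewrite -sum1_card big_mkcond [RHS]big_mkcond.
    apply: eq_bigr => t _; rewrite in_setI [t \in nbrs _ _]inE es.
    by case: (t \in M) => //; case: (e _ _).
  rewrite exchange_big mulnC -sum_nat_const; apply: eq_bigr => t tM.
  rewrite -(two _ tM) -sum1_card big_mkcond [RHS]big_mkcond.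
  apply: eq_bigr => p _; case: ifP => [pQ|pQ].
    rewrite !inE; have [-> _] := QP _ pQ; by case: (e _ _).
  case: ifP => // pt; have := subsetP (subQ _ tM) p pt; by rewrite pQ.
have Qle : 3 * #|Q| <= \sum_(p in Q) #|M :&: nbrs e p|.
  by rewrite -sum1_card big_distrr /=; apply: leq_sum => p /mQ.
have Q2 : 2 <= #|Q| by rewrite -(two _ tmM) subset_leq_card // subQ.
have M5 : #|M| <= 5 by [].
have miss t r p : t \in M -> r \in Q -> ~~ e t r -> #|Q| = 3 -> p \in Q -> p != r ->
    e t p.
  move=> tM rQ ntr cQ pQ pr.
  have /eqP E : nbrs e t :\ b0 == Q :\ r.
    have cQr : #|Q :\ r| <= 2 by have := cardsD1 r Q; rewrite rQ cQ; clear; lia.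
    rewrite eqEcard two // cQr subsetD1 subQ //= in_setD1 [r \in nbrs _ _]inE.
    by rewrite (negbTE ntr) andbF.
  have : p \in nbrs e t :\ b0 by rewrite E in_setD1 pr.
  by rewrite !inE => /andP[].
have [cQ|cQ] : #|Q| = 2 \/ #|Q| = 3 by lia.
  have full t p : t \in M -> p \in Q -> e t p.
    move=> tM pQ; have /eqP E : nbrs e t :\ b0 == Q by rewrite eqEcard subQ // cQ two.
    by move: pQ; rewrite -E !inE => /andP[].
  have [nK33 _] := gK e es em; case: nK33.
  have [p pQ] : exists p, p \in Q by apply/card_gt0P; lia.
  have M3 : 2 < #|M| by apply: leq_trans (mQ _ pQ) _; rewrite subset_leq_card ?subsetIl.
  exists (b0 :: enum Q), (take 3 (enum M)); split.
  - by rewrite /= -cardE cQ.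
  - by rewrite size_takel // -cardE.
  - rewrite cat_uniq /= enum_uniq take_uniq ?enum_uniq // mem_enum !andbT.
    apply/andP; split; first by apply/negP=> /QP[]; rewrite eqxx.
    apply/hasPn=> t /mem_take; rewrite mem_enum => /MT tT; rewrite !inE mem_enum.
    rewrite negb_or TBne //=; apply/negP=> /QB; by rewrite (disjointFr TB tT).
  apply/allrelP=> b t; rewrite !inE => bQ /mem_take; rewrite mem_enum => tM.
  case/orP: bQ => [/eqP->|]; first by rewrite -inM.
  by rewrite mem_enum es; apply: full.
(* In a link on three vertices, each [t] misses at most one of them. Two edges [pq], one [pr] and
   one [qr] give the configuration of [K33_minor_of_star]. *)
have core p q r : p \in Q -> q \in Q -> r \in Q -> uniq [:: p; q; r] ->
    1 < #|M :\: nbrs e r| -> 0 < #|M :\: nbrs e q| -> 0 < #|M :\: nbrs e p| -> False.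
  move=> pQ qQ rQ U /card_gt1P[t1 [t2 [t1M t2M t12]]].
  move=> /card_gt0P[t3 t3M] /card_gt0P[t4 t4M].
  have DP x t : (t \in M :\: nbrs e x) = ~~ e t x && (t \in M).
    by rewrite in_setD [t \in nbrs _ _]inE es.
  move: U t1M t2M t3M t4M; rewrite !DP /= !inE !negb_or -!andbA -!inM.
  case/and4P=> pq pr qr _ /andP[n1 t1M] /andP[n2 t2M] /andP[n3 t3M] /andP[n4 t4M].
  have E t : t \in M -> e t b0 by rewrite inM es.
  have K t x y : t \in M -> x \in Q -> y \in Q -> x != y -> ~~ e t y -> e t x.
    by move=> tM xQ yQ xy nt; apply: (miss t y).
  have qp : q != p by rewrite eq_sym.
  have rp : r != p by rewrite eq_sym.
  have rq : r != q by rewrite eq_sym.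
  have b0p x : x \in Q -> b0 != x by case/QP; rewrite eq_sym.
  have neT x t : x \in B -> t \in M -> x != t by move=> xB /MT tT; rewrite eq_sym TBne.
  have dis t t' x : e t x -> ~~ e t' x -> t != t'.
    by move=> etx; apply: contraNneq => <-.
  apply: (@K33_minor_of_star g e b0 p q r t1 t2 t3 t4 gs gK es em).
  - have t3r : e t3 r by apply: (K _ _ q).
    have t4r : e t4 r by apply: (K _ _ p).
    have t3p : e t3 p by apply: (K _ _ q).
    have t31 := dis _ _ _ t3r n1; have t32 := dis _ _ _ t3r n2.
    have t41 := dis _ _ _ t4r n1; have t42 := dis _ _ _ t4r n2.
    have t34 := dis _ _ _ t3p n4.
    have [pB qB rB] := And3 (QB _ pQ) (QB _ qQ) (QB _ rQ).
    rewrite /= !inE !negb_or pq pr qr t12 t34 !(eq_sym t1) !(eq_sym t2) t31 t32 t41 t42.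
    by rewrite (b0p p) // (b0p q) // (b0p r) // !(neT b0) // !(neT p) // !(neT q) // !(neT r).
  - by rewrite /= E // (K _ p r) // (K _ q r).
  - by rewrite /= E // (K _ p r) // (K _ q r).
  - by rewrite /= E // (K _ p q) // (K _ r q).
  - by rewrite /= E // (K _ q p) // (K _ r p).
(* The numbers of link edges missing [p], [q], [r] add up to [#|M|] and are at most [#|M| - 3]. With
   [#|M| <= 5] they are 2, 2, 1 in some order, so some rotation of [core] applies. *)
have cM p : #|M :\: nbrs e p| = #|M| - #|M :&: nbrs e p|.
  by have := cardsID (nbrs e p) M; lia.
have := enum_uniq Q; have : size (enum Q) = 3 by rewrite -cardE.
have inQ x : x \in enum Q -> x \in Q by rewrite mem_enum.
move: sumQ; rewrite -big_enum; move: inQ.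
case: (enum Q) => [|p [|q [|r []]]] // inQ sumQ _ U.
have [pQ qQ rQ] : [/\ p \in Q, q \in Q & r \in Q].
  by split; apply: inQ; rewrite !inE eqxx ?orbT.
have Mp := mQ _ pQ; have Mq := mQ _ qQ; have Mr := mQ _ rQ.
move: sumQ; rewrite !big_cons big_nil /= addn0.
have Up : uniq [:: q; r; p] by rewrite -(rot_uniq 1) in U.
have Uq : uniq [:: r; p; q] by rewrite -(rot_uniq 1) in Up.
have := core p q r pQ qQ rQ U; have := core q r p qQ rQ pQ Up.
have := core r p q rQ pQ qQ Uq; rewrite !cM.
move: Mp Mq Mr M5; clear.
move: #|M| #|_| #|_| #|_| => m a b c Ma Mb Mc m5 Hc Hb Ha sumQ; exfalso.
have [?|?] : (1 < m - a) \/ (m - a <= 1) by lia.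
  by apply: Hb; lia.
have [?|?] : (1 < m - b) \/ (m - b <= 1) by lia.
  by apply: Hc; lia.
by apply: Ha; lia.
Qed.

End Triples.

(** * Light vertices and list colouring *)

Section LightVertex.

Context {V : finType}.
Implicit Types (e g : rel V) (v w x y z : V) (S T B : {set V}).

Definition nbrs_ge e s v : {set V} := [set y in nbrs e v | s <= deg e y].

(** Keeping three large neighbours for each such vertex gives a bipartite subgraph for
    [card_triples]; [5 < s] makes its sides disjoint. *)
Lemma card_three_big_nbrs g e S s : symmetric g -> no_K33_K5_minor g ->
  symmetric e -> irreflexive e -> minor_of g e -> supported e S -> 5 < s ->
  #|[set v in S | (deg e v <= 5) && (2 < #|nbrs_ge e s v|)]| <=
  2 * #|[set w in S | s <= deg e w]|.
Proof.
move=> gs gK es ei em sup s5; set T := [set v in S | _]; set B := [set w in S | _].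
have TP v : v \in T -> deg e v <= 5 /\ 2 < #|nbrs_ge e s v|.
  by rewrite inE => /and3P[].
have TB : [disjoint T & B].
  rewrite disjoints_subset; apply/subsetP=> v /TP[v5 _]; rewrite !inE negb_and -ltnNge.
  by rewrite (leq_ltn_trans v5 s5) orbT.
have [->|[t0 t0T]] := set_0Vmem T; first by rewrite cards0.
pose h v := [set y in take 3 (enum (nbrs_ge e s v))].
have hP v y : y \in h v -> e v y && (y \in B).
  rewrite inE => /mem_take; rewrite mem_enum !inE => /andP[evy ->].
  by have /andP[_ ->] := sup _ _ evy; rewrite evy.
have h3 v : v \in T -> #|h v| = 3.
  case/TP=> _ v3; rewrite cardsE (card_uniqP _) ?take_uniq ?enum_uniq //.
  by rewrite size_takel // -cardE.
pose f x y := (x \in T) && (y \in h x); pose e' := [rel x y | f x y || f y x].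
have sub : subrel e' e.
  by move=> x y /orP[] /andP[_ /hP/andP[]]; rewrite // es.
have B3 : 2 < #|B|.
  rewrite -(h3 _ t0T); apply/subset_leq_card/subsetP=> y /hP/andP[_ yB] //.
suff : #|T| + 4 <= 2 * #|B| by lia.
apply: (@card_triples _ g e') => //.
- by move=> x y; rewrite /e' /= orbC.
- by move=> x; apply/negP => /sub; rewrite ei.
- exact: minor_sub em sub.
- by move=> x y /orP[] /andP[-> /hP/andP[_ ->]]; rewrite // orbT.
- move=> t tT; rewrite -(h3 _ tT); apply: eq_card => y; rewrite inE /e' /= /f tT /=.
  case: (boolP (y \in h t)) => //= yh; apply/negP=> /andP[_ /hP/andP[_ tB]].
  by rewrite (disjointFr TB tT) in tB.
- exact: ltnW.
Qed.

(* A vertex of degree [d <= 5] has at least three neighbours of degree at least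
   [s] for [2 * (6 - d)] values of [s] in [7, ..., 12], unless it is the vertex
   that we want; summing the previous bound over these [s] contradicts the
   bound on the average degree. *)
Lemma light_vertex g e S : symmetric g -> no_K33_K5_minor g ->
  symmetric e -> irreflexive e -> minor_of g e -> supported e S -> 0 < #|S| ->
  exists2 v, v \in S & deg e v <= 5 /\ #|nbrs_ge e (18 - 2 * deg e v) v| <= 2.
Proof.
move=> gs gK es ei em sup S0.
have [/exists_inP[v vS /andP[]]|] := boolP [exists v in S,
    (deg e v <= 5) && (#|nbrs_ge e (18 - 2 * deg e v) v| <= 2)].
  by exists v.
rewrite negb_exists_in => /forall_inP bad; exfalso.
pose T s := [set v in S | (deg e v <= 5) && (2 < #|nbrs_ge e s v|)].
pose B s := [set w in S | s <= deg e w].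
have TB : \sum_(7 <= s < 13) #|T s| <= 2 * \sum_(7 <= s < 13) #|B s|.
  rewrite big_distrr /= !big_nat; apply: leq_sum => s /andP[s7 _].
  by apply: (card_three_big_nbrs gs gK) => //; apply: ltnW.
have sumI (F : nat -> pred V) :
    \sum_(7 <= s < 13) #|[set v in S | F s v]| =
    \sum_(v in S) \sum_(7 <= s < 13) F s v.
  rewrite exchange_big /=; apply: eq_bigr => s _.
  rewrite -sum1_card big_mkcond [RHS]big_mkcond; apply: eq_bigr => v _.
  by rewrite inE; case: (v \in S) => //=; case: (F s v).
have T_ge : \sum_(v in S) (12 - 2 * deg e v) <= \sum_(7 <= s < 13) #|T s|.
  rewrite sumI; apply: leq_sum => v vS.
  have [d5|d6] := leqP (deg e v) 5; last by lia.
  have := bad v vS; rewrite d5 /= -ltnNge => big3.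
  have d3 : 2 < deg e v.
    by apply: leq_trans big3 _; apply/subset_leq_card/subsetP=> y; rewrite inE => /andP[].
  have mono s : s <= 18 - 2 * deg e v -> 2 < #|nbrs_ge e s v|.
    move=> le_s; apply: leq_trans big3 _; apply/subset_leq_card/subsetP=> y.
    by rewrite ![y \in nbrs_ge _ _ _]inE => /andP[-> /(leq_trans le_s)].
  apply: (@leq_trans (\sum_(7 <= s < 13) (s <= 18 - 2 * deg e v))).
    rewrite unlock /=; clear -d3 d5; lia.
  by apply: leq_sum => s _; case: (boolP (s <= _)) => //= le_s; rewrite mono.
have B_le : \sum_(7 <= s < 13) #|B s| <= \sum_(w in S) (deg e w - 6).
  rewrite sumI; apply: leq_sum => w _; rewrite unlock /=; clear; lia.
have avg := sum_deg_minor gs gK es ei em sup S0.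
(* With truncated subtraction, [12 + 2 * (d - 6) = 2 * d + (12 - 2 * d)] for every [d]. Together
   with the bounds on [T] and [B] this forces [6 * #|S|] to be at most the degree sum, against
   [avg]. *)
have : \sum_(v in S) 12 + 2 * \sum_(w in S) (deg e w - 6) =
       2 * \sum_(v in S) deg e v + \sum_(v in S) (12 - 2 * deg e v).
  rewrite !big_distrr /= -!big_split /=; apply: eq_bigr => v _; lia.
rewrite sum_nat_const; lia.
Qed.

(** For degree [d] in 3, 4, 5, two neighbours may have degree [D] and the others at most
    [17 - 2 * d], adding 11, 18 or 21. With fewer large neighbours, [12 <= D] compensates, as
    [17 - 2 * d <= 11]. *)
Lemma light_vertex_sum_deg e v D : 12 <= D -> (forall x, deg e x <= D) ->
  deg e v <= 5 -> #|nbrs_ge e (18 - 2 * deg e v) v| <= 2 ->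
  \sum_(y in nbrs e v) deg e y <= 2 * D + 21.
Proof.
move=> D12 dD d5 b2; set A := nbrs_ge _ _ _ in b2.
have [d2|d3] := leqP (deg e v) 2.
  apply: (@leq_trans (\sum_(y in nbrs e v) D)); first by apply: leq_sum.
  rewrite sum_nat_const -/(deg e v); nia.
rewrite (big_setID A) /=.
have sumA : \sum_(y in nbrs e v :&: A) deg e y <= #|nbrs e v :&: A| * D.
  by rewrite -sum_nat_const; apply: leq_sum.
have sumN : \sum_(y in nbrs e v :\: A) deg e y <=
    #|nbrs e v :\: A| * (17 - 2 * deg e v).
  rewrite -sum_nat_const; apply: leq_sum => y.
  by rewrite !inE => /andP[H ev]; move: H; rewrite ev /= -ltnNge; lia.
have cA : #|nbrs e v :&: A| <= 2 by apply: leq_trans b2; rewrite subset_leq_card ?subsetIr.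
have := cardsID A (nbrs e v); rewrite -[#|nbrs e v|]/(deg e v).
move: sumA sumN cA d5 d3 D12; clear.
move: (\sum_(y in _) _) (\sum_(y in _) _) #|_| #|_| (deg e v) => b a m c d.
move=> Ha Hb c2 d5 d3 D12 E.
have : [\/ d = 3, d = 4 | d = 5] by case: d d5 d3 {E Hb} => [|[|[|[|[|[|]]]]]] //; constructor.
have : [\/ c = 0, c = 1 | c = 2] by case: c c2 {E Ha} => [|[|[|]]] //; constructor.
by case=> ?; case=> ?; subst c d; lia.
Qed.

End LightVertex.

(** * List colourings of squares *)

Section Coloring.

Context {V C : finType}.
Implicit Types (e g r : rel V) (v w x y z : V) (S : {set V}) (L : V -> {set C}).

Definition list_coloring r L S (c : V -> C) : Prop :=
  {in S, forall x, c x \in L x} /\ {in S &, forall x y, r x y -> c x != c y}.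

Lemma list_coloring_extend r L S v c : symmetric r -> irreflexive r ->
  #|[set y | r v y]| < #|L v| -> list_coloring r L (S :\ v) c ->
  exists c', list_coloring r L S c'.
Proof.
move=> rs ri small [cL cp].
have /subsetPn[a aL an] : ~~ (L v \subset c @: [set y | r v y]).
  apply/negP=> /subset_leq_card; rewrite leqNgt (leq_ltn_trans _ small) //.
  exact: leq_imset_card.
have no_a y : r v y -> c y != a.
  by move=> rvy; apply: contraNneq an => <-; apply: imset_f; rewrite inE.
exists (fun x => if x == v then a else c x); split=> [x xS|x y xS yS rxy].
  by case: eqVneq => [->|xv] //; apply: cL; rewrite !inE xv.
case: (eqVneq x v) => [xv|xv]; case: (eqVneq y v) => [yv|yv].
- by move: rxy; rewrite xv yv ri.
- by rewrite eq_sym no_a // -xv.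
- by rewrite no_a // -yv rs.
- by apply: cp; rewrite // !inE ?xv ?yv.
Qed.

Lemma list_coloring0 r L : (forall x, 0 < #|L x|) -> exists c, list_coloring r L set0 c.
Proof.
move=> L0.
have [c _] : exists c : V -> C, forall v, c v \in L v.
  apply: (@fin_all_exists V (fun=> C) (fun v a => a \in L v)) => v.
  by apply/set0Pn; rewrite -card_gt0.
by exists c; split=> [x|x y]; rewrite inE.
Qed.

Lemma greedy_list_coloring r L S : symmetric r -> irreflexive r ->
  (forall v, #|[set y | r v y]| < #|L v|) -> exists c, list_coloring r L S c.
Proof.
move=> rs ri small; have [n] := ubnP #|S|; elim: n => // n IH in S *.
rewrite ltnS => le_n; have [->|[v vS]] := set_0Vmem S.
  by apply: list_coloring0 => x; apply: leq_ltn_trans (small x).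
have [|c cP] := IH (S :\ v); last exact: list_coloring_extend cP.
by move: le_n; rewrite (cardsD1 v) vS.
Qed.

(** Adjacency in the square of [e], phrased without distances. *)
Definition conflict e : rel V :=
  [rel x y | (x != y) && (e x y || [exists z, e x z && e z y])].

Lemma conflict_sym e : symmetric e -> symmetric (conflict e).
Proof.
move=> es x y; rewrite /conflict /= eq_sym (es x y); congr (_ && (_ || _)).
by apply: eq_existsb => z; rewrite andbC (es x z) (es z y).
Qed.

Lemma conflict_irr e : irreflexive (conflict e).
Proof. by move=> x; rewrite /conflict /= eqxx. Qed.

(** A neighbour [y] of [v] contributes itself and its neighbours other than [v], hence at most
    [deg e y] vertices. *)
Lemma card_conflict e v : symmetric e ->
  #|[set y | conflict e v y]| <= \sum_(y in nbrs e v) deg e y.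
Proof.
move=> es; apply: (@leq_trans #|\bigcup_(y in nbrs e v) (y |: (nbrs e y :\ v))|).
  apply/subset_leq_card/subsetP=> y; rewrite inE => /andP[vy /orP[evy|]].
    by apply/bigcupP; exists y; rewrite !inE ?eqxx.
  case/existsP=> z /andP[evz ezy]; apply/bigcupP; exists z; rewrite !inE //.
  by rewrite ezy [y == v]eq_sym vy orbT.
apply: (@leq_trans (\sum_(y in nbrs e v) #|y |: (nbrs e y :\ v)|)).
  elim/big_rec2: _ => [|y n A _ le_n]; first by rewrite cards0.
  by apply: leq_trans (leq_card_setU _ _) _; rewrite leq_add2l.
apply: leq_sum => y; rewrite inE => evy; rewrite cardsU1 /deg (cardsD1 v (nbrs e y)).
by rewrite [v \in _]inE es evy leq_add2r leq_b1.
Qed.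

(** A path of length two through [v] is rerouted through [w], or shrinks to an edge if one of its
    ends is [w]. *)
Lemma conflict_contract e v w x y : symmetric e -> irreflexive e -> e v w ->
  x != v -> y != v -> conflict e x y -> conflict (contract e v w) x y.
Proof.
move=> es ei evw xv yv /andP[xy H].
have sub a b : a != v -> b != v -> e a b -> contract e v w a b.
  move=> av bv eab; rewrite /contract /= av bv eab andbT.
  by apply: contraTneq eab => ->; rewrite ei.
have wv : w != v by apply: contraTneq evw => ->; rewrite ei.
rewrite /conflict /= xy /=; case/orP: H => [exy|]; first by rewrite -/(contract e v w x y) sub.
case/existsP=> z /andP[exz ezy]; case: (eqVneq z v) => [E|zv]; last first.
  by apply/orP; right; apply/existsP; exists z; apply/andP; split; apply: sub.
move: exz ezy; rewrite {z}E es => evx evy.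
have [xw|xw] := eqVneq x w.
  apply/orP; left; rewrite /contract /= xv yv xy /=.
  by rewrite xw eqxx evy orbT.
have [yw|yw] := eqVneq y w.
  apply/orP; left; rewrite /contract /= xv yv xy /=.
  by rewrite yw eqxx evx !orbT.
apply/orP; right; apply/existsP; exists w; rewrite /contract /= xv yv wv xw.
by rewrite eqxx evx evy [w == y]eq_sym yw !orbT.
Qed.

(* Contracting a light vertex into its neighbour of least degree keeps the
   maximum degree below [D] and preserves all conflicts among the others. *)
Lemma minor_list_coloring g e L S D : symmetric g -> no_K33_K5_minor g ->
  symmetric e -> irreflexive e -> minor_of g e -> supported e S ->
  12 <= D -> (forall x, deg e x <= D) -> (forall x, 2 * D + 22 <= #|L x|) ->
  exists c, list_coloring (conflict e) L S c.
Proof.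
move=> gs gK es ei em sup D12 dD cL; have [n] := ubnP #|S|.
elim: n => // n IH in e S es ei em sup dD *; rewrite ltnS => le_n.
have [S0|[s sS]] := set_0Vmem S.
  by rewrite S0; apply: list_coloring0 => x; apply: leq_trans (cL x); lia.
have [|v vS [d5 b2]] := light_vertex gs gK es ei em sup.
  by apply/card_gt0P; exists s.
have Sv : #|S :\ v| < n by move: le_n; rewrite (cardsD1 v) vS.
have small : #|[set y | conflict e v y]| < #|L v|.
  apply: leq_trans (cL v); apply: leq_ltn_trans (card_conflict v es) _.
  by have := light_vertex_sum_deg D12 dD d5 b2; lia.
suff [c cP] : exists c, list_coloring (conflict e) L (S :\ v) c.
  exact: list_coloring_extend (conflict_sym es) (conflict_irr e) small cP.
(* The merged vertex gets degree at most [deg e w + deg e v - 2]. If [deg e v <= 2], any neighbour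
   will do; otherwise some neighbour has degree at most [17 - 2 * deg e v], and the sum is at most
   14, hence at most [D + 2]. *)
have [d0|[w evw dw]] : deg e v = 0 \/ exists2 w, e v w & deg e w + deg e v <= D + 2.
  have [d2|d3] := leqP (deg e v) 2.
    case: (set_0Vmem (nbrs e v)) => [E|[w]]; first by left; rewrite /deg E cards0.
    by rewrite inE => evw; right; exists w => //; have := dD w; lia.
  have /subsetPn[w] : ~~ (nbrs e v \subset nbrs_ge e (18 - 2 * deg e v) v).
    by apply/negP=> /subset_leq_card; rewrite -/(deg e v); lia.
  rewrite !inE => evw; rewrite evw /= -ltnNge => lw.
  by right; exists w => //; lia.
  apply: IH => //.
  have noe x : e v x = false.
    by move/eqP: d0; rewrite cards_eq0 => /eqP/setP/(_ x); rewrite !inE.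
  move=> x y exy; have /andP[xS yS] := sup _ _ exy; rewrite !inE xS yS !andbT.
  by apply/andP; split; apply: contraTneq exy => ->; rewrite ?noe // es noe.
have vw : v != w by apply: contraTneq evw => ->; rewrite ei.
have [c [cl cp]] : exists c, list_coloring (conflict (contract e v w)) L (S :\ v) c.
  apply: IH => //.
  - exact: contract_sym.
  - exact: contract_irr.
  - exact: minor_contract.
  - exact: contract_supported.
  move=> x; have [->|xw] := eqVneq x w.
    by have := deg_contract_w es ei evw; lia.
  have [->|xv] := eqVneq x v; first by rewrite deg_contract_v.
  by apply: leq_trans (deg_contract_le _ _ _) (dD x).
exists c; split=> // x y xS yS xy; apply: cp => //.
by apply: conflict_contract => //; [move: xS|move: yS]; rewrite !inE => /andP[].
Qed.

End Coloring.

(** * Parity of crossings *)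

(** The eight terms of [crossings_disjoint]: four crossing parities and four [upper] bits. *)
Definition linked (x y z t : bool) (s1 s2 s3 s4 : bool) : bool :=
  xorb x (xorb y (xorb z (xorb t (xorb s1 (xorb s2 (xorb s3 s4)))))).

(** Sum over the 18 pairs of disjoint edges, grouped by [i < k] and [j < l]. Each [x] and [y] occurs
    twice, and [sA], [sAB], [sBA] an even number of times, but [sB j l + sB l j = 1] enters nine
    times. *)
Lemma K33_parity (x y : nat -> nat -> nat -> bool)
    (sA sB sAB sBA : nat -> nat -> bool) :
  (forall j l, j < 3 -> l < 3 -> j != l -> sB l j = ~~ sB j l) ->
  ~ (forall i k j l, i < 3 -> k < 3 -> j < 3 -> l < 3 -> i != k -> j != l ->
     linked (x i j k) (y i j l) (x k l i) (y k l j)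
       (sA i k) (sAB i l) (sBA j k) (sB j l) = false).
Proof.
move=> asym H.
pose r i k j l := linked (x i j k) (y i j l) (x k l i) (y k l j)
       (sA i k) (sAB i l) (sBA j k) (sB j l).
pose s3 := [:: (0, 1); (0, 2); (1, 2)].
pose b := foldr xorb false [seq xorb (r ik.1 ik.2 jl.1 jl.2) (r ik.1 ik.2 jl.2 jl.1) |
  ik <- s3, jl <- s3].
have b0 : b = false by rewrite /b /= /r !H.
suff : b = true by rewrite b0.
rewrite /b /= /r /linked (asym 0 1) // (asym 0 2) // (asym 1 2) //; btauto.
Qed.

(** Sum over the 15 pairs of disjoint edges. Each [x] occurs twice and each unordered pair enters
    [s] six times; the reversals of [s] are odd in number for a pair of edges exactly when these
    interleave, which happens once per four vertices, so five times. *)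
Lemma K5_parity (x : nat -> nat -> nat -> bool) (s : nat -> nat -> bool) :
  (forall a b, a < 5 -> b < 5 -> a != b -> s b a = ~~ s a b) ->
  ~ (forall a b c d, a < b -> c < d -> b < 5 -> d < 5 -> uniq [:: a; b; c; d] ->
     linked (x a b c) (x a b d) (x c d a) (x c d b)
       (s a c) (s a d) (s b c) (s b d) = false).
Proof.
move=> asym H.
pose r (e f : nat * nat) := let: (a, b) := e in let: (c, d) := f in
  linked (x a b c) (x a b d) (x c d a) (x c d b) (s a c) (s a d) (s b c) (s b d).
pose m := foldr xorb false [:: r (0, 1) (2, 3); r (0, 1) (2, 4); r (0, 1) (3, 4);
  r (0, 2) (1, 3); r (0, 2) (1, 4); r (0, 2) (3, 4); r (0, 3) (1, 2);
  r (0, 3) (1, 4); r (0, 3) (2, 4); r (0, 4) (1, 2); r (0, 4) (1, 3);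
  r (0, 4) (2, 3); r (1, 2) (3, 4); r (1, 3) (2, 4); r (1, 4) (2, 3)].
have m0 : m = false by rewrite /m /= /r !H.
suff : m = true by rewrite m0.
rewrite /m /= /r /linked !(asym 1 2) // !(asym 1 3) // !(asym 1 4) //.
rewrite !(asym 2 3) // !(asym 2 4) // !(asym 3 4) //; btauto.
Qed.

(** * Crossing parities of disjoint polylines *)

Section Polylines.
Local Open Scope ring_scope.

Context {R : realFieldType}.
Implicit Types (p q u v : R * R) (P Q : seq (R * R)) (d : R).

(* Membership in a half-plane, closed on exactly one of its two boundary rays,
   so that exactly one of [u] and [- u] belongs to it for [u != 0]. *)
Definition upper u : bool := (0 < u.2) || ((u.2 == 0) && (0 < u.1)).

(* The step from [u] to [v] crosses the positive horizontal ray.  This is only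
   meaningful for steps that are short compared to the norm of [u]. *)
Definition crosses u v : bool := xorb (upper u) (upper v) && (0 < u.1).

Definition close d p q : bool := (`|p.1 - q.1| <= d) && (`|p.2 - q.2| <= d).

(** The factor 2 allows for one step on each polyline: together they move [p - q] by at most [2 * d]
    in the sup norm. *)
Definition far d p q : bool := (2 * d < `|p.1 - q.1|) || (2 * d < `|p.2 - q.2|).

Lemma upperN u : u != 0 -> upper (- u) = ~~ upper u.
Proof.
case: u => x y; rewrite /upper /= => xy0.
rewrite oppr_eq0 !oppr_gt0; case: (ltgtP y 0) => //= y0.
case: (ltgtP x 0) => //= x0; by move: xy0; rewrite x0 y0 eqxx.
Qed.

Lemma upper_ge0 u : if upper u then 0 <= u.2 else u.2 <= 0.
Proof.
by rewrite /upper; case: (ltrgtP 0 u.2) => //= _; case: ifP.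
Qed.

(** A change of half-plane within distance [2 * d] keeps the second coordinates within [2 * d] of 0.
    Farness then makes the first coordinates larger than that, too large for a change of sign. *)
Lemma upper_change d u v w : upper u != upper v ->
  far d u 0 -> far d v 0 -> far d w 0 ->
  close (2 * d) u v -> close (2 * d) u w -> close (2 * d) v w ->
  (0 < w.1) = (0 < u.1).
Proof.
have := upper_ge0 u; have := upper_ge0 v; rewrite /far /close /= !subr0.
move=> hv hu uv fu _ fw /andP[_ yuv] /andP[xuw yuw] /andP[_ yvw].
have [nu nw] : `|u.2| <= 2 * d /\ `|w.2| <= 2 * d.
  move: uv hu hv yuv yuw yvw; rewrite !ler_norml; clear.
  by case: (upper u); case: (upper v) => // _ hu hv *; split; lra.
move: fu fw xuw; rewrite ![2 * d < `|_.2|]ltNge nu nw !orbF ler_norml !ltr_normr; clear.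
by case/orP=> ? /orP[?|?] ?; apply/idP/idP => ?; lra.
Qed.

Lemma close_refl d u : 0 <= d -> close d u u.
Proof. by rewrite /close !subrr normr0 => ->. Qed.

Lemma close_sym d u v : close d u v = close d v u.
Proof. by rewrite /close distrC [X in _ && (X <= _)]distrC. Qed.

Lemma close_trans d d' u v w : close d u v -> close d' v w -> close (d + d') u w.
Proof.
case: u v w => [? ?] [? ?] [? ?]; rewrite /close !ler_norml /=; lra.
Qed.

Lemma close_ge0 d u v : close d u v -> 0 <= d.
Proof. by case/andP=> /(le_trans (normr_ge0 _)). Qed.

Lemma close_subl d p q q' : close d (p - q) (p - q') = close d q q'.
Proof.
rewrite close_sym /close; have -> : (p - q').1 - (p - q).1 = q.1 - q'.1 by rewrite /=; lra.
by have -> : (p - q').2 - (p - q).2 = q.2 - q'.2 by rewrite /=; lra.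
Qed.

Lemma close_subr d p p' q : close d (p - q) (p' - q) = close d p p'.
Proof.
rewrite /close; have -> : (p - q).1 - (p' - q).1 = p.1 - p'.1 by rewrite /=; lra.
by have -> : (p - q).2 - (p' - q).2 = p.2 - p'.2 by rewrite /=; lra.
Qed.

Lemma far_sub d p q : far d (p - q) 0 = far d p q.
Proof. by rewrite /far /= !subr0. Qed.

Lemma far_sym d p q : far d p q = far d q p.
Proof. by rewrite /far distrC [X in _ || (_ < X)]distrC. Qed.

Lemma far_neq d p q : 0 <= d -> far d p q -> p - q != 0.
Proof.
move=> d0; apply: contraTneq => /eqP; rewrite subr_eq0 => /eqP ->.
by rewrite /far !subrr normr0 orbb -leNgt; lra.
Qed.

(** If [upper] is constant on the four corners, nothing crosses. Otherwise [upper_change] gives the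
    corners from which steps start first coordinates of equal sign, and the changes of [upper]
    around the cell cancel. *)
Lemma crosses_cell d p p' q q' : close d p p' -> close d q q' ->
  far d p q -> far d p q' -> far d p' q -> far d p' q' ->
  xorb (crosses (p - q) (p' - q)) (crosses (p - q') (p' - q')) =
  xorb (crosses (p - q) (p - q')) (crosses (p' - q) (p' - q')).
Proof.
move=> pp qq; rewrite -(far_sub d p q) -(far_sub d p q').
rewrite -(far_sub d p' q) -(far_sub d p' q').
set a := p - q; set b := p - q'; set c := p' - q; set e := p' - q'.
have dd : 2 * d = d + d by lra.
have d0 := close_ge0 pp.
have up u v : close d u v -> close (2 * d) u v.
  by move=> uv; rewrite dd; apply: close_trans uv (close_refl _ d0).
have ab : close d a b by rewrite close_subl.
have ac : close d a c by rewrite close_subr.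
have be : close d b e by rewrite close_subr.
have ce : close d c e by rewrite close_subl.
have ae : close (2 * d) a e by rewrite dd; apply: close_trans ab be.
have bc : close (2 * d) b c by rewrite dd; apply: close_trans ac; rewrite close_sym.
move: ab ac be ce => /up ab /up ac /up be /up ce fa fb fc fe.
have cs := close_sym (2 * d).
rewrite /crosses.
have [ab'|/negPf ab'] := eqVneq (upper a) (upper b); last first.
  have cE := upper_change (negbT ab') fa fb fc ab ac bc.
  have bE : (0 < b.1) = (0 < a.1).
    by apply: (upper_change (negbT ab') fa fb fb) => //; apply: close_refl; lra.
  rewrite cE bE; case: (0 < a.1); rewrite ?andbF ?andbT //; btauto.
have [ac'|/negPf ac'] := eqVneq (upper a) (upper c); last first.
  have bE := upper_change (negbT ac') fa fc fb ac ab ltac:(by rewrite cs).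
  have cE : (0 < c.1) = (0 < a.1).
    by apply: (upper_change (negbT ac') fa fc fc) => //; apply: close_refl; lra.
  rewrite cE bE; case: (0 < a.1); rewrite ?andbF ?andbT //; btauto.
have [ae'|/negPf ae'] := eqVneq (upper a) (upper e); last first.
  have bE := upper_change (negbT ae') fa fe fb ae ab ltac:(by rewrite cs).
  have cE := upper_change (negbT ae') fa fe fc ae ac ltac:(by rewrite cs).
  rewrite cE bE; case: (0 < a.1); rewrite ?andbF ?andbT //; btauto.
by rewrite -ab' -ac' -ae'; case: (upper a).
Qed.

(** A step that changes half-plane crosses the positive or the negative horizontal ray, and negation
    exchanges the two. *)
Lemma crossesN d u v : close d u v -> far d u 0 -> far d v 0 ->
  crosses (- u) (- v) = xorb (crosses u v) (xorb (upper u) (upper v)).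
Proof.
move=> uv fu fv; have d0 := close_ge0 uv.
have u0 := far_neq d0 fu; have v0 := far_neq d0 fv; rewrite subr0 in u0; rewrite subr0 in v0.
rewrite /crosses !upperN //.
have [->|uv'] := eqVneq (upper u) (upper v); first by case: (upper v).
have cc : close (2 * d) u v.
  have -> : 2 * d = d + d by lra.
  exact: close_trans uv (close_refl _ d0).
have -> : (0 < (- u).1) = ~~ (0 < u.1).
  rewrite /= oppr_gt0 -leNgt le_eqVlt.
  suff -> : u.1 == 0 = false by [].
  apply/negP => /eqP u10.
  have := upper_ge0 u; have := upper_ge0 v; move: uv' fu cc.
  rewrite /far /close /= !subr0 u10 normr0 !ler_norml.
  case: (upper u); case: (upper v) => // _ /orP[?|]; rewrite ?lter_normr; lra.
by move: uv'; case: (upper u); case: (upper v); case: (0 < u.1).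
Qed.

(** Parity of the crossings of the polyline [p :: P] with the ray going right from [c]. *)
Fixpoint crossings c p P : bool :=
  if P is p' :: P' then xorb (crosses (p - c) (p' - c)) (crossings c p' P') else false.

Fixpoint cocrossings c q Q : bool :=
  if Q is q' :: Q' then xorb (crosses (c - q) (c - q')) (cocrossings c q' Q') else false.

Definition all_far d p P q Q : bool := allrel (far d) (p :: P) (q :: Q).

Lemma xorb_swap (a b c d : bool) :
  xorb (xorb a b) (xorb c d) = xorb (xorb a c) (xorb b d).
Proof. btauto. Qed.

Lemma crossings_strip d p P q q' : path (close d) p P -> close d q q' ->
  all_far d p P q [:: q'] ->
  xorb (crossings q p P) (crossings q' p P) =
  xorb (crosses (p - q) (p - q')) (crosses (last p P - q) (last p P - q')).
Proof.
move=> + qq; elim: P p => [|p' P IH] p /=; first by move=> _ _; case: crosses.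
case/andP=> pp' pP; rewrite /all_far allrel_consl => /andP[/= /and3P[f1 f2 _] fP].
have [/andP[f3 /andP[f4 _]] _] := andP fP.
rewrite xorb_swap (IH _ pP fP) (crosses_cell pp' qq f1 f2 f3 f4); btauto.
Qed.

(** Sum of [crosses_cell] over the grid [P * Q]: inner edges cancel and the boundary remains. *)
Lemma crossings_grid d p P q Q : path (close d) p P -> path (close d) q Q ->
  all_far d p P q Q ->
  xorb (crossings q p P) (crossings (last q Q) p P) =
  xorb (cocrossings p q Q) (cocrossings (last p P) q Q).
Proof.
move=> pP; elim: Q q => [|q' Q IH] q /=; first by move=> _ _; case: crossings.
case/andP=> qq' qQ; rewrite /all_far allrel_consr => /andP[f1 f2].
have fs : all_far d p P q [:: q'].
  rewrite /all_far allrel_consr f1 allrel_consr allrel0r andbT.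
  by move: f2; rewrite allrel_consr => /andP[].
rewrite xorb_swap -(IH _ qQ f2) -(crossings_strip pP qq' fs); btauto.
Qed.

(** Apply [crossesN] to each step; the changes of half-plane telescope. *)
Lemma cocrossingsE d c q Q : path (close d) q Q -> all_far d q Q c [::] ->
  cocrossings c q Q =
  xorb (crossings c q Q) (xorb (upper (q - c)) (upper (last q Q - c))).
Proof.
elim: Q q => [|q' Q IH] q /=; first by case: (upper _).
case/andP=> qq' qQ; rewrite /all_far allrel_consl => /andP[/= /andP[f1 _] fQ].
rewrite (IH _ qQ fQ); have [/andP[f2 _] _] := andP fQ.
rewrite -(far_sub d q c) in f1; rewrite -(far_sub d q' c) in f2.
have -> : crosses (c - q) (c - q') = crosses (- (q - c)) (- (q' - c)).
  by rewrite !opprB.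
rewrite (@crossesN d) ?close_subr //; btauto.
Qed.

Lemma crossings_disjoint d p P q Q : path (close d) p P -> path (close d) q Q ->
  all_far d p P q Q ->
  xorb (crossings q p P) (xorb (crossings (last q Q) p P)
  (xorb (crossings p q Q) (xorb (crossings (last p P) q Q)
  (xorb (upper (q - p)) (xorb (upper (last q Q - p))
  (xorb (upper (q - last p P)) (upper (last q Q - last p P)))))))) = false.
Proof.
move=> pP qQ f; have := crossings_grid pP qQ f.
have fc c : c \in p :: P -> all_far d q Q c [::].
  move=> cP; apply/allrelP=> x y xQ; rewrite inE => /eqP ->.
  by rewrite far_sym; apply: (allrelP f).
rewrite (cocrossingsE qQ (fc _ _)) ?mem_head // (cocrossingsE qQ (fc _ _)) ?mem_last //.
move: (crossings q p P) (crossings (last q Q) p P) (crossings p q Q)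
  (crossings (last p P) q Q) (upper (q - p)) (upper (last q Q - p))
  (upper (q - last p P)) (upper (last q Q - last p P)).
by do 8!case.
Qed.

Lemma K33_polylines d (A B : nat -> R * R) (L : nat -> nat -> seq (R * R)) :
  0 <= d ->
  (forall i j, i < 3 -> j < 3 ->
     path (close d) (A i) (L i j) /\ last (A i) (L i j) = B j)%N ->
  ~ (forall i j k l, i < 3 -> j < 3 -> k < 3 -> l < 3 -> i != k -> j != l ->
     all_far d (A i) (L i j) (A k) (L k l))%N.
Proof.
move=> d0 HL Hf.
apply: (@K33_parity (fun i j k => crossings (A k) (A i) (L i j))
  (fun i j l => crossings (B l) (A i) (L i j))
  (fun i k => upper (A k - A i)) (fun j l => upper (B l - B j))
  (fun i l => upper (B l - A i)) (fun j k => upper (A k - B j))).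
  move=> j l j3 l3 jl; rewrite -upperN ?opprB //.
  (* [B j] and [B l] differ because they end the disjoint edges from [A 0] and [A 1]. *)
  have := Hf 0%N j 1%N l isT j3 isT l3 isT jl.
  have [_ <-] := HL 0%N j isT j3; have [_ <-] := HL 1%N l isT l3 => f.
  by apply: (far_neq d0); rewrite far_sym; apply: (allrelP f); apply: mem_last.
move=> i k j l i3 k3 j3 l3 ik jl.
have [pP EP] := HL _ _ i3 j3; have [pQ EQ] := HL _ _ k3 l3.
by have := crossings_disjoint pP pQ (Hf _ _ _ _ i3 j3 k3 l3 ik jl); rewrite EP EQ.
Qed.

Lemma K5_polylines d (A : nat -> R * R) (L : nat -> nat -> seq (R * R)) :
  (forall i j, i < 5 -> j < 5 -> i != j -> A i != A j)%N ->
  (forall i j, i < j -> j < 5 ->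
     path (close d) (A i) (L i j) /\ last (A i) (L i j) = A j)%N ->
  ~ (forall i j k l, i < j -> k < l -> j < 5 -> l < 5 -> uniq [:: i; j; k; l] ->
     all_far d (A i) (L i j) (A k) (L k l))%N.
Proof.
move=> neq HL Hf.
apply: (@K5_parity (fun i j k => crossings (A k) (A i) (L i j))
  (fun i j => upper (A j - A i))).
  by move=> i j i5 j5 ij; rewrite -upperN ?opprB // subr_eq0 neq // eq_sym.
move=> a b c e ab ce b5 e5 U.
have [pP EP] := HL _ _ ab b5; have [pQ EQ] := HL _ _ ce e5.
by have := crossings_disjoint pP pQ (Hf _ _ _ _ ab ce b5 e5 U); rewrite EP EQ.
Qed.

End Polylines.

(** * Sampling continuous arcs *)

Section Sampling.
Local Open Scope classical_set_scope.
Local Open Scope ring_scope.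

Context {R : realType}.

Lemma fin_common_bound (T : finType) (P : R -> T -> Prop) :
  (forall d d' x, 0 < d' -> d' <= d -> P d x -> P d' x) ->
  (forall x, exists2 d, 0 < d & P d x) -> exists2 d, 0 < d & forall x, P d x.
Proof.
move=> mono ex.
suff [d d0 H] : exists2 d, 0 < d & forall x, x \in enum T -> P d x.
  by exists d => // x; apply: H; rewrite mem_enum.
elim: (enum T) => [|a s [d d0 IH]]; first by exists 1.
have [d' d'0 Pa] := ex a; have m0 : 0 < Num.min d d' by rewrite lt_min d0.
exists (Num.min d d') => // x; rewrite inE => /orP[/eqP->|xs].
  by apply: mono Pa; rewrite // ge_min lexx orbT.
by apply: mono (IH _ xs); rewrite // ge_min lexx.
Qed.

Lemma compact_far (f g : R -> R * R) :
  {within `[0, 1], continuous f} -> {within `[0, 1], continuous g} ->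
  (forall s t : R, s \in `[0, 1]%R -> t \in `[0, 1]%R -> f s <> g t) ->
  exists2 d : R, 0 < d & forall s t : R,
    s \in `[0, 1]%R -> t \in `[0, 1]%R -> far d (f s) (g t).
Proof.
move=> cf cg fg.
pose A := f @` `[0, 1]; pose B := g @` `[0, 1].
have cA : compact A by apply: continuous_compact => //; apply: segment_compact.
have cB : compact B by apply: continuous_compact => //; apply: segment_compact.
pose h (z : (R * R) * (R * R)) : R := `|z.1.1 - z.2.1| + `|z.1.2 - z.2.2|.
have ch : continuous h.
  move=> z; apply: cvgD; apply: cvg_norm; apply: cvgB.
  - exact: (cvg_comp _ _ cvg_fst cvg_fst).
  - exact: (cvg_comp _ _ cvg_snd cvg_fst).
  - exact: (cvg_comp _ _ cvg_fst cvg_snd).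
  - exact: (cvg_comp _ _ cvg_snd cvg_snd).
have AB0 : A `*` B !=set0.
  by exists (f 0, g 0); split; exists 0; rewrite //= in_itv /= lexx ler01.
have [z zAB hz] := compact_EVT_min AB0 (compact_setX cA cB) (continuous_subspaceT ch).
move: zAB => /set_mem[[s s01 fs] [t t01 gt]].
have m0 : 0 < h z.
  rewrite lt_neqAle addr_ge0 // andbT eq_sym paddr_eq0 // !normr_eq0 !subr_eq0 -fs -gt.
  apply/negP=> /andP[/eqP E1 /eqP E2]; apply: (fg _ _ s01 t01).
  by apply/eqP/andP; rewrite E1 E2.
(* A coordinate sum of at least [h z] has a term of at least [h z / 2], more than
   [2 * (h z / 8)]. *)
exists (h z / 8); first by rewrite divr_gt0.
move=> s' t' s'01 t'01.
have : h z <= h (f s', g t') by apply/hz/mem_set; split; [exists s'|exists t'].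
rewrite {2}/h /far /= => H; apply/orP.
by have [?|?] := ltP (2 * (h z / 8)) `|(f s').1 - (g t').1|; [left|right; lra].
Qed.

Lemma unif_close (f : R -> R * R) (d : R) : {within `[0, 1], continuous f} -> 0 < d ->
  exists2 r : R, 0 < r & forall s t : R, s \in `[0, 1]%R -> t \in `[0, 1]%R ->
    `|s - t| < r -> close d (f s) (f t).
Proof.
move=> cf d0.
have /compact_near_coveringP cov := @segment_compact R 0 1.
pose P (r s : R) := s \in `[0, 1]%R -> forall t : R, t \in `[0, 1]%R ->
  `|s - t| < r -> close d (f s) (f t).
have /= nearP : \forall r \near 0^'+, `[0, 1] `<=` P r.
  apply: cov => s s01.
  move: (cf) => /subspace_continuousP/(_ s s01) cfs.
  have /cfs : nbhs (f s) (ball (f s) (d / 2)) by apply: nbhsx_ballx; rewrite divr_gt0.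
  rewrite /= /fmap /within /= => /nbhs_ballP[r /= r0 sub].
  (* Halving keeps both [x] and any [t] within [r / 2] of [x] inside the ball of radius [r] around
     [s]. *)
  exists (ball s (r / 2), [set i | i < r / 2]); first split=> /=.
  - by apply: nbhsx_ballx; rewrite divr_gt0.
  - by apply: nbhs_right_lt; rewrite divr_gt0.
  move=> [x i] /= [sx ir] x01 t t01 xt.
  have closeb y : ball s r y -> y \in `[0, 1]%R -> close (d / 2) (f s) (f y).
    by move=> /sub /[apply] -[]; rewrite /ball /= => /ltW ? /ltW ?; apply/andP.
  have -> : d = d / 2 + d / 2 by lra.
  apply: (@close_trans _ _ _ _ (f s)).
    rewrite close_sym; apply: closeb => //; apply: le_ball sx; lra.
  apply: closeb => //; rewrite /ball /= in sx *.
  have := ler_distD x s t; lra.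
have [r [r0 Pr]] : exists r, 0 < r /\ `[0, 1] `<=` P r.
  near (0 : R)^'+ => r; exists r; split; first by near: r; apply: nbhs_right_gt.
  by near: r.
by exists r => // s t s01 t01; apply: Pr.
Unshelve. all: by end_near. Qed.

End Sampling.

(** * Plane drawings *)

Section Drawings.
Local Open Scope ring_scope.

Context {R : realType} {G : sgraph} (pt : G -> R * R) (arc : G -> G -> R -> R * R).
Context (drawing : plane_drawing pt arc).

(** Interior points are separated by [arc_cross]; an end of one arc is a vertex off the other edge,
    excluded by [arc_vertex] and [pt_inj]. *)
Lemma arcs_disjoint (u v u' v' : G) (s t : R) :
  adj u v -> adj u' v' -> [disjoint [:: u; v] & [:: u'; v']] ->
  s \in `[0, 1] -> t \in `[0, 1] -> arc u v s <> arc u' v' t.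
Proof.
case: drawing => pi _ _ a0 a1 _ av ac uv uv' dis.
have ends a b c r : adj a b -> c \notin [:: a; b] -> r \in `[0, 1] -> arc a b r <> pt c.
  move=> ab cab r01; move: cab; rewrite !inE negb_or => /andP[ca cb].
  move: r01; rewrite in_itv /= => /andP[]; rewrite le_eqVlt => /orP[/eqP<- _|r0].
    by rewrite a0 // => /pi E; rewrite E eqxx in ca.
  rewrite le_eqVlt => /orP[/eqP->|r1].
    by rewrite a1 // => /pi E; rewrite E eqxx in cb.
  by apply: av; rewrite // in_itv /= r0.
have nin c : c \in [:: u; v] -> c \notin [:: u'; v'] by move=> /(disjointFr dis) ->.
have nin' c : c \in [:: u'; v'] -> c \notin [:: u; v] by move=> /(disjointFl dis) ->.
move=> s01 t01; have := s01; rewrite in_itv /= => /andP[].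
rewrite le_eqVlt => /orP[/eqP<- _|s0].
  by rewrite a0 // => /esym; apply: ends; rewrite // nin // inE eqxx.
rewrite le_eqVlt => /orP[/eqP->|s1].
  by rewrite a1 // => /esym; apply: ends; rewrite // nin // !inE eqxx orbT.
have := t01; rewrite in_itv /= => /andP[].
rewrite le_eqVlt => /orP[/eqP<- _|t0].
  by rewrite a0 //; apply: ends; rewrite // nin' // inE eqxx.
rewrite le_eqVlt => /orP[/eqP->|t1].
  by rewrite a1 //; apply: ends; rewrite // nin' // !inE eqxx orbT.
have := nin u; rewrite !inE eqxx => /(_ isT); rewrite negb_or => /andP[/eqP uu' /eqP uv''].
by apply: ac; rewrite ?in_itv /= ?s0 ?t0 // => -[].
Qed.

Lemma arcs_far : exists2 d : R, 0 < d & forall (u v u' v' : G) (s t : R),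
  adj u v -> adj u' v' -> [disjoint [:: u; v] & [:: u'; v']] ->
  s \in `[0, 1] -> t \in `[0, 1] -> far d (arc u v s) (arc u' v' t).
Proof.
pose P (d : R) (q : G * G * (G * G)) :=
  adj q.1.1 q.1.2 -> adj q.2.1 q.2.2 -> [disjoint [:: q.1.1; q.1.2] & [:: q.2.1; q.2.2]] ->
  forall s t : R, s \in `[0, 1] -> t \in `[0, 1] ->
  far d (arc q.1.1 q.1.2 s) (arc q.2.1 q.2.2 t).
have [d d0 H] : exists2 d, 0 < d & forall q, P d q.
  apply: fin_common_bound.
    move=> d d' q d'0 dd' Pd uv uv' dis s t s01 t01.
    have := Pd uv uv' dis s t s01 t01; rewrite /far => /orP[?|?]; apply/orP.
      by left; lra.
    by right; lra.
  move=> [[u v] [u' v']]; rewrite /P /=.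
  have [uv|nuv] := boolP (adj u v); last by exists 1 => // uv; rewrite uv in nuv.
  have [uv'|nuv] := boolP (adj u' v'); last by exists 1 => // _ uv'; rewrite uv' in nuv.
  have [dis|ndis] := boolP [disjoint [:: u; v] & [:: u'; v']]; last first.
    by exists 1 => // _ _ dis; rewrite dis in ndis.
  have cont := arc_cont drawing.
  have [d d0 H] := compact_far (cont _ _ uv) (cont _ _ uv')
    (fun s t => arcs_disjoint uv uv' dis).
  by exists d.
by exists d => // u v u' v' s t uv uv' dis; apply: (H ((u, v), (u', v'))).
Qed.

Lemma arcs_sampling (d : R) : 0 < d -> exists2 n : nat, (0 < n)%N &
  forall u v k, adj u v -> (k < n)%N ->
  close d (arc u v (k%:R / n%:R)) (arc u v (k.+1%:R / n%:R)).
Proof.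
move=> d0.
pose P (r : R) (q : G * G) := adj q.1 q.2 -> forall s t : R,
  s \in `[0, 1] -> t \in `[0, 1] -> `|s - t| < r -> close d (arc q.1 q.2 s) (arc q.1 q.2 t).
have [r r0 H] : exists2 r, 0 < r & forall q, P r q.
  apply: fin_common_bound.
    by move=> r r' q _ rr' Pr uv s t s01 t01 st; apply: Pr => //; apply: lt_le_trans rr'.
  move=> [u v]; rewrite /P /=.
  have [uv|nuv] := boolP (adj u v); last by exists 1 => // uv; rewrite uv in nuv.
  by have [r r0 H] := unif_close (arc_cont drawing uv) d0; exists r.
pose n := (Num.bound r^-1).+1.
have n0 : 0 < n%:R :> R by rewrite ltr0n.
have nr : n%:R^-1 < r.
  rewrite invf_plt ?posrE //; apply: lt_le_trans (archi_boundP _) _.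
    by rewrite invr_ge0 ltW.
  by rewrite ler_nat.
exists n => // u v k uv kn; apply: (H (u, v)) => //=.
- by rewrite in_itv /= divr_ge0 // ler_pdivrMr // mul1r ler_nat ltnW.
- by rewrite in_itv /= divr_ge0 // ler_pdivrMr // mul1r ler_nat.
by rewrite -mulrBl -natr1 opprD addNKr mulN1r normrN gtr0_norm // invr_gt0.
Qed.

(** The start [pt u] is left out and the end [pt v] included, so that the lists of consecutive edges
    concatenate. *)
Definition samples (n : nat) (u v : G) : seq (R * R) :=
  [seq arc u v (k.+1%:R / n%:R) | k <- iota 0 n].

Fixpoint walk_samples (n : nat) (u : G) (p : seq G) : seq (R * R) :=
  if p is v :: p' then samples n u v ++ walk_samples n v p' else [::].

Lemma samples_path (d : R) n (u v : G) : (0 < n)%N -> adj u v ->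
  (forall k, (k < n)%N ->
    close d (arc u v (k%:R / n%:R)) (arc u v (k.+1%:R / n%:R))) ->
  path (close d) (pt u) (samples n u v) /\ last (pt u) (samples n u v) = pt v.
Proof.
move=> n0 uv H; rewrite -(arc_start drawing uv) -(arc_end drawing uv) /samples.
pose f k := arc u v (k%:R / n%:R).
have -> : arc u v 0 = f 0%N by rewrite /f mul0r.
have -> : arc u v 1 = f n by rewrite /f divff // pnatr_eq0 -lt0n.
have gen m l : (m + l <= n)%N ->
    path (close d) (f m) [seq f k.+1 | k <- iota m l] /\
    last (f m) [seq f k.+1 | k <- iota m l] = f (m + l)%N.
  elim: l m => [|l IH] m; first by rewrite addn0.
  move=> ml /=; have [|-> ->] := IH m.+1; first by rewrite addSnnS.
  by rewrite H ?addSnnS //; lia.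
exact: gen.
Qed.

Lemma walk_samples_path (d : R) n (u : G) p : (0 < n)%N -> path (@adj G) u p ->
  (forall a b k, adj a b -> (k < n)%N ->
    close d (arc a b (k%:R / n%:R)) (arc a b (k.+1%:R / n%:R))) ->
  path (close d) (pt u) (walk_samples n u p) /\
  last (pt u) (walk_samples n u p) = pt (last u p).
Proof.
move=> n0 + H; elim: p u => [|v p IH] u //= /andP[uv vp].
have [sp sl] := samples_path n0 uv (fun k => H u v k uv).
by rewrite cat_path last_cat sl sp; have [] := IH v vp.
Qed.

(** Traces each sample back to an edge of the walk; nonemptiness puts the starting point on an arc
    too. *)
Lemma walk_samples_mem n (u : G) p x : (0 < n)%N -> path (@adj G) u p ->
  p != [::] -> x \in pt u :: walk_samples n u p ->
  exists a b t, [/\ a \in u :: p, b \in u :: p, adj a b, t \in `[0, 1] & x = arc a b t].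
Proof.
move=> n0; elim: p u => // v p IH u /= /andP[uv vp] _.
have uP : u \in [:: u, v & p] by rewrite mem_head.
have vP : v \in [:: u, v & p] by rewrite !inE eqxx orbT.
rewrite inE mem_cat => /or3P[/eqP->|/mapP[k]|xp].
- by exists u, v, 0; rewrite (arc_start drawing uv) in_itv /= lexx ler01.
- rewrite mem_iota add0n => /andP[_ kn] ->; exists u, v, (k.+1%:R / n%:R); split=> //.
  by rewrite in_itv /= divr_ge0 // ler_pdivrMr ?ltr0n // mul1r ler_nat.
case: p IH vp xp uP vP => // w p IH vp xp _ _.
have [//||a [b [t [aP bP ab t01 ->]]]] := IH v vp; first by rewrite inE xp orbT.
by exists a, b, t; rewrite inE aP orbT inE bP orbT.
Qed.

Lemma induced_path (A : {set G}) x p : path (induced (@adj G) A) x p ->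
  path (@adj G) x p && all [in A] p.
Proof.
elim: p x => //= y p IH x /andP[/and3P[xA yA xy] /IH/andP[-> ->]].
by rewrite xy yA.
Qed.

Lemma drawing_no_minor : no_K33_K5_minor (@adj G).
Proof.
move=> e es [U [Uc Ud Ue]].
have [d d0 fard] := arcs_far.
have [n n0 closed] := arcs_sampling d0.
(* A representative of each branch set; the default [x] serves only empty branch sets, whose
   vertices are isolated in [e]. *)
pose c x := odflt x [pick a in U x].
have cU x y : e x y -> c x \in U x.
  move=> /Ue[a [b [aU _ _]]]; rewrite /c; case: pickP => // /(_ a).
  by rewrite aU.
have dUc x y a : a \in U x -> a \in U y -> x = y.
  by move=> ax ay; apply/eqP; apply: contraTT ay => /Ud/disjointFr ->.
(* Walk inside [U x] to an edge [ab] of [G], cross it, and walk inside [U y] to the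
   representative. *)
have exw (q : G * G) : exists p : seq G, e q.1 q.2 -> [/\ path (@adj G) (c q.1) p,
    last (c q.1) p = c q.2 & {subset c q.1 :: p <= U q.1 :|: U q.2}].
  case: q => x y /=; have [exy|] := boolP (e x y); last by exists [::].
  have cx := cU _ _ exy; have cy : c y \in U y by apply: (cU y x); rewrite es.
  have [a [b [ax bY ab]]] := Ue _ _ exy.
  have /connectP[p1 /induced_path/andP[P1 A1] l1] := Uc x _ _ cx ax.
  have /connectP[p2 /induced_path/andP[P2 A2] l2] := Uc y _ _ bY cy.
  exists (p1 ++ b :: p2) => _; split.
  - by rewrite cat_path P1 -l1 /= ab.
  - by rewrite last_cat /= -l2.
  move=> z; rewrite inE mem_cat inE in_setU => /or4P[/eqP->|/(allP A1)->|/eqP->|/(allP A2)->].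
  + by rewrite cx.
  + by [].
  + by rewrite bY orbT.
  + by rewrite orbT.
have [w wP] := choice exw.
pose L x y := walk_samples n (c x) (w (x, y)).
have Lpath x y : e x y ->
    path (close d) (pt (c x)) (L x y) /\ last (pt (c x)) (L x y) = pt (c y).
  move=> exy; have [p1 l1 _] := wP (x, y) exy.
  by have := walk_samples_path n0 p1 closed; rewrite l1.
have wne x y : x != y -> e x y -> w (x, y) != [::].
  move=> xy exy; have [_ l1 _] := wP (x, y) exy; apply: contra xy => /eqP E.
  move: l1; rewrite E /= => cxy; apply/eqP; apply: (@dUc x y (c x)); first exact: cU exy.
  by rewrite cxy; apply: (cU y x); rewrite es.
(* Branch sets of four distinct vertices are disjoint, so edges on the two walks share no end and
   [fard] applies. *)
have Lfar x y x' y' : e x y -> e x' y' -> uniq [:: x; y; x'; y'] ->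
    all_far d (pt (c x)) (L x y) (pt (c x')) (L x' y').
  move=> exy exy'; rewrite /= !inE !negb_or -!andbA.
  case/and5P=> xy xx' xy' yx' /and3P[yy' x'y' _].
  have [p1 l1 s1] := wP (x, y) exy; have [p2 l2 s2] := wP (x', y') exy'.
  apply/allrelP => q q' qL qL'.
  have [a [b [t [aP bP ab t01 ->]]]] := walk_samples_mem n0 p1 (wne _ _ xy exy) qL.
  have [a' [b' [t' [aP' bP' ab' t01' ->]]]] := walk_samples_mem n0 p2 (wne _ _ x'y' exy') qL'.
  apply: fard => //.
  have sep z : z \in U x :|: U y -> z \notin U x' :|: U y'.
    rewrite !inE negb_or => zU; apply/andP; split; apply/negP => zU';
      by case/orP: zU => zU; [move: xx' xy'|move: yx' yy'];
         rewrite (dUc _ _ _ zU zU') eqxx.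
  rewrite disjoint_has; apply/negP => /hasP[z zab zab'].
  have mem2 (A : {set G}) x1 x2 : x1 \in A -> x2 \in A -> z \in [:: x1; x2] -> z \in A.
    by move=> ? ?; rewrite !inE => /orP[] /eqP->.
  have := sep z (mem2 _ _ _ (s1 _ aP) (s1 _ bP) zab).
  by rewrite (mem2 _ _ _ (s2 _ aP') (s2 _ bP') zab').
split.
  case=> s [t [s3 t3 st est]].
  have x0 : G by case: s s3 {st est}.
  pose S i := nth x0 s i; pose T i := nth x0 t i.
  have eST i j : (i < 3)%N -> (j < 3)%N -> e (S i) (T j).
    by move=> i3 j3; apply: (allrelP est); apply: mem_nth; rewrite ?s3 ?t3.
  apply: (@K33_polylines _ d (fun i => pt (c (S i))) (fun j => pt (c (T j)))
    (fun i j => L (S i) (T j)) (ltW d0)).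
    by move=> i j i3 j3; apply: Lpath; apply: eST.
  move=> i j k l i3 j3 k3 l3 ik jl; apply: Lfar; try exact: eST.
  move: st; rewrite cat_uniq => /and3P[us /hasPn dis ut].
  have ST a b : (a < 3)%N -> (b < 3)%N -> S a != T b.
    move=> a3 b3; apply: contraTneq (dis (T b) (mem_nth _ _)) => [<-|]; rewrite ?t3 //.
    by rewrite negbK /= mem_nth ?s3.
  have TS a b : (a < 3)%N -> (b < 3)%N -> T a != S b by move=> *; rewrite eq_sym ST.
  have SS : S i != S k by rewrite nth_uniq ?s3.
  have TT : T j != T l by rewrite nth_uniq ?t3.
  by rewrite /= !inE !negb_or SS TT !ST // TS.
case=> s [s5 us es5].
have x0 : G by case: s s5 {us es5}.
pose S i := nth x0 s i.
have eS i j : (i < j)%N -> (j < 5)%N -> e (S i) (S j).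
  move=> ij j5; apply: (pairwiseP x0 es5); rewrite ?inE ?s5 //.
  exact: ltn_trans j5.
(* Each index needs some neighbour in [e] to have a nonempty branch set: 1 serves for 0, and 0 for
   the rest. *)
have cUS i : (i < 5)%N -> c (S i) \in U (S i).
  case: i => [|i] i5; first by apply: (cU _ (S 1%N)); apply: eS.
  by apply: (cU _ (S 0%N)); rewrite es; apply: eS.
apply: (@K5_polylines _ d (fun i => pt (c (S i))) (fun i j => L (S i) (S j))).
- move=> i j i5 j5 ij; apply: contraNneq ij => /(pt_inj drawing) E.
  have : S i = S j by apply: dUc (cUS _ i5) _; rewrite E cUS.
  by move/eqP; rewrite nth_uniq ?s5.
- by move=> i j ij j5; apply: Lpath; apply: eS.
move=> i j k l ij kl j5 l5 U4; apply: Lfar; try exact: eS.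
rewrite -[[:: S i; _; _; _]]/(map S [:: i; j; k; l]) map_inj_in_uniq //.
have [i5 k5] := (ltn_trans ij j5, ltn_trans kl l5).
have lt5 a : a \in [:: i; j; k; l] -> (a < 5)%N.
  by rewrite !inE => /or4P[] /eqP->.
move=> a b /lt5 a5 /lt5 b5 /eqP; rewrite nth_uniq ?s5 //.
by move/eqP.
Qed.

End Drawings.

(** * The list chromatic number of the square *)

Lemma square_adj_conflict (G : sgraph) (u v : G) :
  square_adj u v -> conflict (@adj G) u v.
Proof.
move=> uv; apply/andP; split.
  by apply: contraTneq uv => ->; rewrite square_adj_irr.
case/orP: uv => /andP[/existsP[[[|x [|y []]] //= sz] /andP[]]].
  by rewrite andbT => ux /eqP <- _; rewrite ux.
rewrite andbT => /andP[ux xy] /eqP <- _; apply/orP; right.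
by apply/existsP; exists x; rewrite ux.
Qed.

Lemma list_chromatic_number_le (H : sgraph) k :
  choosable H k -> list_chromatic_number H <= k.
Proof.
by move=> ck; rewrite /list_chromatic_number; case: ex_minnP => m _; apply; apply/asboolP.
Qed.

Theorem theorem6p9 (R : realType) (G : sgraph) :
  planar R G ->
  list_chromatic_number (square G) <= 2 * max_degree G + 34.
Proof.
case=> pt [arc drawing]; apply: list_chromatic_number_le => C L cL.
have gs := @adj_sym G; have gi := @adj_irr G.
have degM x : deg (@adj G) x <= max_degree G.
  by rewrite /deg cardsE; apply: (leq_bigmax x).
suff [c [cl cp]] : exists c, list_coloring (conflict (@adj G)) L [set: G] c.
  exists c; split=> [x|x y /square_adj_conflict xy]; first by apply: cl; rewrite inE.
  by apply: cp; rewrite ?inE.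
(* With [D = maxn (max_degree G) 12], the bound [2 * D + 22] is at most [2 * max_degree G + 34] once
   the maximum degree is at least 6. Below that, a vertex has at most 25 conflicts and greedy
   colouring suffices. *)
have [small|big] := leqP (max_degree G) 5.
  apply: greedy_list_coloring; [exact: conflict_sym|exact: conflict_irr|].
  move=> v; rewrite cL; apply: leq_ltn_trans (card_conflict v gs) _.
  apply: (@leq_ltn_trans (5 * 5)); last by lia.
  apply: (@leq_trans (\sum_(y in nbrs (@adj G) v) 5)).
    by apply: leq_sum => y _; apply: leq_trans small.
  by rewrite sum_nat_const leq_mul2r; apply: leq_trans (degM v) small.
apply: (@minor_list_coloring _ _ _ _ _ _ (maxn (max_degree G) 12) gs
  (drawing_no_minor drawing) gs gi (minor_refl _)) => //.
- by move=> x y _; rewrite !inE.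
- by rewrite leq_maxr.
- by move=> x; rewrite leq_max degM.
by move=> x; rewrite cL; lia.
Qed.
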